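(* Let $0<q<1$, let $a,b$ be real with $0<a<q^{-1}$ and $b<q^{-1}$, and let $v\in\mathbb{C}$. Let $(P_n)_{n\ge0}$ be the monic matrix-valued orthogonal polynomials with respect to $\langle\cdot,\cdot\rangle_W$ with weight matrix $$W(q^x)=a^x\frac{(bq;q)_x}{(q;q)_x}A^x(A^* )^x,\quad x\in\mathbb{N},\qquad A=\begin{pmatrix}q&-v(1-q)\\0&1\end{pmatrix},$$ and let $\tilde P_n=N_nP_n$. Then for all $m,n\ge0$ $$\langle\tilde P_m,\tilde P_n\rangle_W=H_n\delta_{m,n},$$ where $H_n$ is the diagonal matrix $$H_n=\mathrm{diag}\Bigl(|\kappa_{11}^n|^2h_n(aq^2,b;q)+|\kappa_{12}^n|^2h_{n+1}(a,b;q),\ |\kappa_{21}^n|^2h_{n-1}(aq^2,b;q)+|\kappa_{22}^n|^2h_n(a,b;q)\Bigr).$$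
   Context: $\mathbb{N}=\{0,1,2,\dots\}$; $(c;q)_n=\prod_{i=0}^{n-1}(1-cq^i)$, $(c;q)_\infty=\prod_{i\ge0}(1-cq^i)$, $(c_1,c_2;q)_n=(c_1;q)_n(c_2;q)_n$. The inner product is $\langle P,Q\rangle_W=\sum_{x=0}^\infty q^xP(q^x)W(q^x)Q(q^x)^*$ on polynomials with coefficients in $\mathrm{Mat}_2(\mathbb{C})$; the monic orthogonal polynomials are the unique sequence $(P_n)$ with $P_n$ of degree $n$, leading coefficient $I$, and $\langle P_m,P_n\rangle_W=0$ for $m\ne n$. Further $$N_n=\begin{pmatrix}1&\alpha_n\\0&1\end{pmatrix},\quad\alpha_n=v\,\frac{1-q^n+aq^{n+1}-abq^{2n+2}}{1-abq^{2n+2}},$$ $$h_n(a,b;q)=\frac{(abq^2;q)_\infty}{(aq;q)_\infty}\frac{(1-abq)(aq)^n}{(1-abq^{2n+1})}\frac{(q,bq;q)_n}{(aq,abq;q)_n}$$ (when $1-abq=0$ the formula is read after cancelling the factor $1-abq$ against that in $(abq;q)_n$ for $n\ge1$, and against $1-abq^{2n+1}$ for $n=0$), $$\kappa_{11}^n=(-1)^nq^{\binom n2}\frac{(aq^3;q)_n}{(abq^{n+3};q)_n},\qquad \kappa_{12}^n=(-1)^{n+1}v\,q^{\binom{n+1}2}\frac{(aq;q)_{n+1}}{(abq^{n+2};q)_{n+1}},$$ $$\kappa_{21}^n=(-1)^n\xi_n\,a\overline{v}\,q^{\binom n2-n+2}\frac{(1-q^n)(1-bq^n)}{(1-aq)(1-aq^2)}\frac{(aq;q)_n}{(abq^{n+1};q)_n},\qquad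 \kappa_{22}^n=(-1)^n\xi_n\,q^{\binom n2}\frac{(aq;q)_n}{(abq^{n+1};q)_n},$$ $$\xi_n=\left(1+aq|v|^2\frac{(1-q^n)(1-bq^n)}{(1-abq^{n+1})(1-aq^{n+1})}\right)^{-1}.$$ For $n=0$ the term $|\kappa_{21}^0|^2h_{-1}(aq^2,b;q)$ is zero. *)

(* Defs.v *)
From HB Require Import structures.
From mathcomp Require Import all_boot all_order all_algebra.
From mathcomp Require Import all_classical all_reals all_analysis.
From mathcomp Require Import complex.

Set Implicit Arguments.
Unset Strict Implicit.
Unset Printing Implicit Defensive.

Import Order.TTheory GRing.Theory Num.Theory numFieldNormedType.Exports.

Local Open Scope ring_scope.
Local Open Scope complex_scope.
Local Open Scope classical_set_scope.
Local Open Scope sesquilinear_scope.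

Definition mx2 (K : Type) (x y z t : K) : 'M[K]_2 :=
  \matrix_(i, j) (if i == 0 then if j == 0 then x else y
                  else if j == 0 then z else t).

Section QShifted.
Context {R : realType}.
Implicit Types (a b c q : R) (n : nat).

Definition qpoch c q n : R := \prod_(i < n) (1 - c * q ^+ i).

Definition qpochoo c q : R := limn (qpoch c q).

(* (1 - abq) / ((1 - abq^(2n+1)) (abq; q)_n); when 1 - abq = 0, the factor
   1 - abq is cancelled against the first factor of (abq; q)_n if n >= 1, and
   against 1 - abq^(2n+1) if n = 0. *)
Definition hfrac a b q n : R :=
  if 1 - a * b * q == 0 then
    if n is m.+1 then
      1 / ((1 - a * b * q ^+ (2 * n + 1)) * qpoch (a * b * q ^+ 2) q m)
    else 1
  else
    (1 - a * b * q)
      / ((1 - a * b * q ^+ (2 * n + 1)) * qpoch (a * b * q) q n).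

Definition hnorm a b q n : R :=
  qpochoo (a * b * q ^+ 2) q / qpochoo (a * q) q
  * hfrac a b q n * (a * q) ^+ n
  * (qpoch q q n * qpoch (b * q) q n / qpoch (a * q) q n).

End QShifted.

Section MatrixWeight.
Context {R : realType}.
Variables (a b q : R) (v : R[i]).
Implicit Types (n x : nat) (P Q : {poly 'M[R[i]]_2}).

Definition Amx : 'M[R[i]]_2 := mx2 q%:C (- v * (1 - q)%:C) 0 1.

(* The value of the weight at the point q^x. *)
Definition weight x : 'M[R[i]]_2 :=
  (a ^+ x * (qpoch (b * q) q x / qpoch q q x))%:C
    *: (Amx ^+ x *m (Amx ^t*) ^+ x).

Definition ip_term P Q x : 'M[R[i]]_2 :=
  let y := (q ^+ x)%:C in
  y *: (P.[y%:M] *m weight x *m Q.[y%:M] ^t*).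

(* R[i] is read as a numFieldType to give it the topology of its modulus;
   'M_2 then carries the entrywise topology. *)
Definition ip_partial P Q : nat -> 'M[R[i] : numFieldType]_2 :=
  series (ip_term P Q).

Definition ip P Q : 'M[R[i]]_2 := limn (ip_partial P Q).

Definition monic_orthogonal (P : nat -> {poly 'M[R[i]]_2}) : Prop :=
  (forall n, size (P n) = n.+1 /\ P n \is monic) /\
  (forall m n, m <> n -> ip (P m) (P n) = 0).

Definition alpha n : R[i] :=
  v * ((1 - q ^+ n + a * q ^+ n.+1 - a * b * q ^+ (2 * n + 2))
         / (1 - a * b * q ^+ (2 * n + 2)))%:C.

Definition Nmx n : 'M[R[i]]_2 := mx2 1 (alpha n) 0 1.

(* For n = 0 the denominator may vanish (abq = 1), but the numerator is 0 and
   x / 0 = 0, so xi 0 = 1 in all cases. *)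
Definition xi n : R[i] :=
  (1 + (a * q)%:C * `|v| ^+ 2
       * (((1 - q ^+ n) * (1 - b * q ^+ n))
            / ((1 - a * b * q ^+ n.+1) * (1 - a * q ^+ n.+1)))%:C)^-1.

Definition kappa11 n : R[i] :=
  ((-1) ^+ n * q ^+ 'C(n, 2)
   * (qpoch (a * q ^+ 3) q n / qpoch (a * b * q ^+ (n + 3)) q n))%:C.

Definition kappa12 n : R[i] :=
  (-1) ^+ n.+1 * v
  * (q ^+ 'C(n.+1, 2)
     * (qpoch (a * q) q n.+1 / qpoch (a * b * q ^+ (n + 2)) q n.+1))%:C.

Definition kappa21 n : R[i] :=
  (-1) ^+ n * xi n * a%:C * Num.conj v
  * (q ^ ('C(n, 2)%:Z - n%:Z + 2)
     * ((1 - q ^+ n) * (1 - b * q ^+ n) / ((1 - a * q) * (1 - a * q ^+ 2)))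
     * (qpoch (a * q) q n / qpoch (a * b * q ^+ n.+1) q n))%:C.

Definition kappa22 n : R[i] :=
  (-1) ^+ n * xi n
  * (q ^+ 'C(n, 2)
     * (qpoch (a * q) q n / qpoch (a * b * q ^+ n.+1) q n))%:C.

(* The term with h_(n-1) is 0 at n = 0, where h_(-1) is not defined. *)
Definition Hmx n : 'M[R[i]]_2 :=
  mx2 (`|kappa11 n| ^+ 2 * (hnorm (a * q ^+ 2) b q n)%:C
       + `|kappa12 n| ^+ 2 * (hnorm a b q n.+1)%:C)
      0
      0
      ((if n is m.+1 then
          `|kappa21 n| ^+ 2 * (hnorm (a * q ^+ 2) b q m)%:C else 0)
       + `|kappa22 n| ^+ 2 * (hnorm a b q n)%:C).

End MatrixWeight.

(* Main.v *)
Require Import Defs.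
From HB Require Import structures.
From mathcomp Require Import all_boot all_order all_algebra.
From mathcomp Require Import all_classical all_reals all_analysis.
From mathcomp Require Import complex.
From mathcomp Require Import ring lra.

Set Implicit Arguments.
Unset Strict Implicit.
Unset Printing Implicit Defensive.

Import Order.TTheory GRing.Theory Num.Theory numFieldNormedType.Exports.

Local Open Scope ring_scope.
Local Open Scope complex_scope.
Local Open Scope classical_set_scope.

(** Writing [y = q^x], the power [A^x] is affine in [y]: a row [(r1, r2)] of a
    matrix polynomial [P] satisfies
    [(r1, r2) A^x = (y r1, r2 - v (1 - y) r1)].
    Hence, in the coordinates [f1 = r1] and [f2 = r2 - v (1 - y) r1], the
    matrix inner product splits into two scalar ones: [f1] is integrated
    against the little q-Jacobi weight with parameters [(a q^2, b)], the
    factor [y^2] having been absorbed by [a], and [f2] against the one with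
    parameters [(a, b)] ([ip_term_entry], [ip_cvg]).  The price is a twisted
    degree condition: [P] has degree at most [n] iff [f1] does, [f2] has
    degree at most [n + 1], and the top coefficient of [f2] is [v] times the
    coefficient of [y^n] in [f1].

    With [p_n] and [p'_n] the monic little q-Jacobi polynomials for [(a, b)]
    and [(a q^2, b)], this suggests the matrix polynomial [mvlqj n] whose two
    rows are [(p'_n, v p_(n+1))] and [(mu_n p'_(n-1), xi_n p_n)] in these
    coordinates.  The number [mu_n] ([mixing]) makes the second row of degree
    [n] orthogonal to the first row of degree [n - 1], and [xi_n] makes the
    leading coefficient unipotent.  The second coefficients of [p_n] and
    [p'_n] show that this leading coefficient is [N_n] ([lead_mvlqj]).
    Orthogonality to all lower degrees ([mvlqj_orthogonal]) and invertible
    norms ([mvlqj_norm_neq0]) then force [N_n P_n = mvlqj n] for every monic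
    orthogonal sequence ([mvlqj_unique]), and the norms are read off from the
    scalar ones ([ip_mvlqj], [Hmx_mvlqj_norm]).

    The scalar theory rests on the moments.  By the q-binomial theorem
    ([q_binomial]) the [j]-th moment is
    [(a b q^(j+2); q)_oo / (a q^(j+1); q)_oo], so convergence and every later
    identity reduce to algebra on moments.  The raising operator [raise] is
    adjoint to the q-difference operator [qdiff], up to the shift
    [(a, b) -> (a q, b q)] of the parameters ([raise_adjoint]); iterating it
    from the constant 1 produces the monic polynomials [lqj], and
    orthogonality, norms and the two top coefficients follow by induction on
    the degree. *)

(** * The q-binomial theorem *)

Section QBinomial.
Context {R : realType}.
Implicit Types (c z q r w : R) (n k : nat) (t : R^nat).

(** The bound only has to hold eventually, so the finitely many first terms are
    put into the constant of the geometric majorant. *)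
Lemma ratio_test t r : 0 < r -> r < 1 -> (forall k, 0 <= t k) ->
  (\forall k \near \oo, t k.+1 <= r * t k) -> cvgn (series t).
Proof.
move=> r0 r1 t0 [K _ tK].
pose M := \sum_(i < K.+1) t i / r ^+ i.
have tM k : t k <= M * r ^+ k.
  have [kK|Kk] := ltnP k K.+1.
    rewrite -ler_pdivrMr ?exprn_gt0 // /M (bigD1 (Ordinal kK)) //= lerDl.
    by apply: sumr_ge0 => i _; rewrite divr_ge0 // exprn_ge0 // ltW.
  elim: k Kk => // k IHk; rewrite ltnS leq_eqVlt => /predU1P[<-|Kk].
    apply: le_trans (tK K (leqnn K)) _.
    rewrite exprS mulrCA ler_pM2l // -ler_pdivrMr ?exprn_gt0 //.
    rewrite /M (bigD1 ord_max) //= lerDl.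
    by apply: sumr_ge0 => i _; rewrite divr_ge0 // exprn_ge0 // ltW.
  apply: le_trans (tK k (ltnW Kk)) _.
  by rewrite exprS mulrCA ler_pM2l // IHk.
apply: (series_le_cvg t0 _ tM); last first.
  by apply: is_cvg_geometric_series; rewrite gtr0_norm.
by move=> k; apply: le_trans (tM k).
Qed.

Lemma qpoch0 c q : qpoch c q 0 = 1.
Proof. by rewrite /qpoch big_ord0. Qed.

Lemma qpochSr c q n : qpoch c q n.+1 = qpoch c q n * (1 - c * q ^+ n).
Proof. by rewrite /qpoch big_ord_recr. Qed.

Lemma qpochS c q n : qpoch c q n.+1 = (1 - c) * qpoch (c * q) q n.
Proof.
rewrite /qpoch big_ord_recl expr0 mulr1; congr (_ * _).
by apply: eq_bigr => i _; rewrite exprS mulrA.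
Qed.

Lemma qpoch_gt0 c q n : 0 < q -> q < 1 -> c < 1 -> 0 < qpoch c q n.
Proof.
move=> q0 q1 c1; apply: prodr_gt0 => i _; rewrite subr_gt0.
have qi0 : 0 < q ^+ i by rewrite exprn_gt0.
have qi1 : q ^+ i <= 1 by rewrite exprn_ile1 // ltW.
nra.
Qed.

Definition qbin_term c q z k : R := qpoch c q k / qpoch q q k * z ^+ k.

Definition qbin_sum c q z n : R := series (qbin_term c q z) n.

Definition qbin c q z : R := limn (qbin_sum c q z).

Lemma qbin_sum0 c q z : qbin_sum c q z 0 = 0.
Proof. by rewrite /qbin_sum /series /= big_geq. Qed.

Lemma qbin_sumS c q z n :
  qbin_sum c q z n.+1 = qbin_sum c q z n + qbin_term c q z n.
Proof. exact: seriesSr. Qed.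

Lemma qbin_term_ge0 c q z k :
  0 < q -> q < 1 -> c < 1 -> 0 <= z -> 0 <= qbin_term c q z k.
Proof.
move=> q0 q1 c1 z0; rewrite /qbin_term mulr_ge0 ?exprn_ge0 //.
by rewrite divr_ge0 // ltW //; exact: qpoch_gt0.
Qed.

Lemma qbin_termS c q z k : 0 < q -> q < 1 ->
  qbin_term c q z k.+1 * (1 - q ^+ k.+1)
    = z * (1 - c * q ^+ k) * qbin_term c q z k.
Proof.
move=> q0 q1; rewrite /qbin_term !qpochSr -exprS.
have := qpoch_gt0 k q0 q1 q1.
have : q ^+ k.+1 < 1 by rewrite exprn_ilt1 // ltW.
move: (q ^+ k.+1) (qpoch q q k) => u p u1 p0.
by rewrite exprS; field; rewrite !gt_eqF // subr_gt0.
Qed.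

Lemma is_cvg_qbin c q z : 0 < q -> q < 1 -> c < 1 -> 0 < z -> z < 1 ->
  cvgn (qbin_sum c q z).
Proof.
move=> q0 q1 c1 z0 z1; pose r := (1 + z) / 2.
have r0 : 0 < r by rewrite /r; lra.
have r1 : r < 1 by rewrite /r; lra.
have rz : 0 < r - z by rewrite /r; lra.
apply: (ratio_test r0 r1) => [k|].
  by apply: qbin_term_ge0 => //; exact: ltW.
(* The ratio of consecutive terms is at most [r] as soon as
   [(r q - z c) q^k <= r - z]. *)
pose e := (r - z) / (`|r * q - z * c| + 1).
have e0 : 0 < e by rewrite divr_gt0 // ltr_wpDl.
have qe : \forall k \near \oo, `|q ^+ k| < e.
  have : (fun k => q ^+ k) @ \oo --> (0 : R).
    by apply: cvg_expr; rewrite gtr0_norm.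
  by move/cvgr0_norm_lt => /(_ e e0).
near=> k.
have qk0 : 0 < q ^+ k by rewrite exprn_gt0.
have qk1 : q ^+ k.+1 < 1 by rewrite exprn_ilt1 // ltW.
have qke : q ^+ k < e by rewrite -(gtr0_norm qk0); near: k.
have t0 : 0 <= qbin_term c q z k by apply: qbin_term_ge0 => //; exact: ltW.
have := qbin_termS c z k q0 q1.
rewrite -(ler_pM2r (x := 1 - q ^+ k.+1)) ?subr_gt0 // => ->.
rewrite [leRHS]mulrAC ler_wpM2r //.
have : `|r * q - z * c| * q ^+ k <= r - z.
  have : (`|r * q - z * c| + 1) * q ^+ k <= r - z.
    by rewrite mulrC -ler_pdivlMr ?ltW // ltr_wpDl.
  by apply: le_trans; rewrite ler_pM2r // lerDl.
have := ler_norm (r * q - z * c); rewrite exprS; nra.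
Unshelve. all: by end_near. Qed.

Lemma cvg_qbin c q z : 0 < q -> q < 1 -> c < 1 -> 0 < z -> z < 1 ->
  qbin_sum c q z @ \oo --> qbin c q z.
Proof. by move=> *; apply: is_cvg_qbin. Qed.

(** The q-difference equation of the q-binomial series already holds exactly for
    its partial sums; passing to the limit gives [qbin_shift]. *)
Lemma qbin_sum_shift c q z n : 0 < q -> q < 1 ->
  qbin_sum c q z n.+1 - qbin_sum c q (q * z) n.+1
    = z * qbin_sum c q z n
      - c * z * qbin_sum c q (q * z) n.
Proof.
move=> q0 q1; elim: n => [|n IHn].
  by rewrite !qbin_sumS !qbin_sum0 /qbin_term !expr0; ring.
rewrite qbin_sumS [qbin_sum c q (q * z) n.+2]qbin_sumS opprD addrACA IHn.
rewrite !qbin_sumS.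
have := qbin_termS c z n q0 q1.
have dil k : qbin_term c q (q * z) k = q ^+ k * qbin_term c q z k.
  by rewrite /qbin_term exprMn mulrCA.
rewrite !dil mulrBr mulr1 (mulrC _ (q ^+ n.+1)) => ->; ring.
Qed.

Lemma qbin_shift c q z : 0 < q -> q < 1 -> c < 1 -> 0 < z -> z < 1 ->
  qbin c q z * (1 - z) = (1 - c * z) * qbin c q (q * z).
Proof.
move=> q0 q1 c1 z0 z1.
have qz0 : 0 < q * z by rewrite mulr_gt0.
have qz1 : q * z < 1 by nra.
have cz := cvg_qbin q0 q1 c1 z0 z1; have cqz := cvg_qbin q0 q1 c1 qz0 qz1.
have lhs : (fun n => qbin_sum c q z n.+1
    - qbin_sum c q (q * z) n.+1) @ \oo
    --> qbin c q z - qbin c q (q * z).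
  by apply: cvgB; rewrite cvg_shiftS.
have rhs : (fun n => qbin_sum c q z n.+1
    - qbin_sum c q (q * z) n.+1) @ \oo
    --> z * qbin c q z - c * z * qbin c q (q * z).
  under eq_cvg do rewrite qbin_sum_shift //.
  by apply: cvgB; apply: cvgMr.
have e : qbin c q z - qbin c q (q * z)
    = z * qbin c q z - c * z * qbin c q (q * z).
  by rewrite -(cvg_lim _ lhs) // -(cvg_lim _ rhs).
by rewrite mulrBr mulr1 mulrBl mul1r; move: e; move: (qbin c q z) => x; lra.
Qed.

(** Iterating [qbin_shift] moves the argument towards 0, where the series tends
    to its constant term 1; this is what identifies the infinite products. *)
Lemma qbin_iter c q z n : 0 < q -> q < 1 -> c < 1 -> 0 < z -> z < 1 ->
  qbin c q z * qpoch z q n = qpoch (c * z) q n * qbin c q (q ^+ n * z).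
Proof.
move=> q0 q1 c1 z0 z1; elim: n => [|n IHn].
  by rewrite !qpoch0 expr0 mulr1 !mul1r.
have qn0 : 0 < q ^+ n by rewrite exprn_gt0.
have qn1 : q ^+ n <= 1 by rewrite exprn_ile1 // ltW.
rewrite !qpochSr mulrA IHn exprS -[_ * q ^+ n * z]mulrA -mulrA.
rewrite (mulrC z) qbin_shift // ?mulr_gt0 //; last by nra.
by rewrite -!mulrA (mulrC z).
Qed.

Lemma qbin_sum_ge1 c q z n : 0 < q -> q < 1 -> c < 1 -> 0 < z ->
  1 <= qbin_sum c q z n.+1.
Proof.
move=> q0 q1 c1 z0; rewrite /qbin_sum /series /= big_nat_recl //=.
rewrite {1}/qbin_term !qpoch0 expr0 divr1 mulr1 lerDl.
by apply: sumr_ge0 => i _; apply: qbin_term_ge0 => //; exact: ltW.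
Qed.

Lemma qbin_ge1 c q z : 0 < q -> q < 1 -> c < 1 -> 0 < z -> z < 1 ->
  1 <= qbin c q z.
Proof.
move=> q0 q1 c1 z0 z1.
apply: limr_ge; first exact: is_cvg_qbin.
near=> n; have n0 : (0 < n)%N by near: n; exists 1%N.
by rewrite -(prednK n0) qbin_sum_ge1.
Unshelve. all: by end_near. Qed.

(** Replacing [z] by [w z] multiplies every term but the constant one by at most
    [w], so the series is continuous at 0 along [w z]. *)
Lemma qbin_sum_dilate_le c q z w n : 0 < q -> q < 1 -> c < 1 -> 0 < z ->
  0 < w -> w <= 1 -> qbin_sum c q (w * z) n.+1 <= 1 + w * qbin_sum c q z n.+1.
Proof.
move=> q0 q1 c1 z0 w0 w1; elim: n => [|n IHn].
  rewrite !qbin_sumS !qbin_sum0 !add0r /qbin_term !qpoch0 !expr0.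
  by rewrite divr1 !mulr1 lerDl ltW.
rewrite qbin_sumS [qbin_sum c q z n.+2]qbin_sumS mulrDr addrA lerD //.
have t0 : 0 <= qbin_term c q z n.+1 by apply: qbin_term_ge0 => //; exact: ltW.
rewrite [X in X <= _](_ : _ = w ^+ n.+1 * qbin_term c q z n.+1); last first.
  by rewrite /qbin_term exprMn mulrCA.
by rewrite ler_wpM2r // exprS -[leRHS]mulr1 ler_pM2l // exprn_ile1 // ltW.
Qed.

Lemma qbin_dilate_le c q z w : 0 < q -> q < 1 -> c < 1 -> 0 < z -> z < 1 ->
  0 < w -> w <= 1 -> qbin c q (w * z) <= 1 + w * qbin c q z.
Proof.
move=> q0 q1 c1 z0 z1 w0 w1.
have wz0 : 0 < w * z by rewrite mulr_gt0.
have wz1 : w * z < 1 by nra.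
have czw := cvg_qbin q0 q1 c1 wz0 wz1; have cz := cvg_qbin q0 q1 c1 z0 z1.
have rhs : (fun n => 1 + w * qbin_sum c q z n) @ \oo
    --> 1 + w * qbin c q z by apply: cvgD; [exact: cvg_cst|exact: cvgMr].
rewrite -(cvg_lim _ rhs) //.
apply: ler_lim; [exact: is_cvg_qbin|by apply/cvg_ex; eexists; exact: rhs|].
near=> n; have n0 : (0 < n)%N by near: n; exists 1%N.
by rewrite -(prednK n0) qbin_sum_dilate_le.
Unshelve. all: by end_near. Qed.

Lemma cvg_qbin_near0 c q z : 0 < q -> q < 1 -> c < 1 -> 0 < z -> z < 1 ->
  (fun n => qbin c q (q ^+ n * z)) @ \oo --> (1 : R).
Proof.
move=> q0 q1 c1 z0 z1.
apply: (@squeeze_cvgr _ _ _ _ (fun=> 1) (fun n => 1 + q ^+ n * qbin c q z)).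
- near=> n; have qn0 : 0 < q ^+ n by rewrite exprn_gt0.
  have qn1 : q ^+ n <= 1 by rewrite exprn_ile1 // ltW.
  by rewrite qbin_dilate_le // andbT qbin_ge1 // ?mulr_gt0 //; nra.
- exact: cvg_cst.
- have e : 1 + 0 * qbin c q z = 1 by rewrite mul0r addr0.
  rewrite -[X in _ --> X]e; apply: cvgD; first exact: cvg_cst.
  by apply: cvgMl; apply: cvg_expr; rewrite gtr0_norm.
Unshelve. all: by end_near. Qed.

(** The numerator disappears for [c = 0], so this special case computes the
    infinite product by itself and shows that it does not vanish; the products
    with [c z] in place of [z], of arbitrary sign, follow in [cvg_qpoch]. *)
Lemma cvg_qpoch01 q z : 0 < q -> q < 1 -> 0 < z -> z < 1 ->
  qpoch z q @ \oo --> (qbin 0 q z)^-1.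
Proof.
move=> q0 q1 z0 z1.
have F1 := qbin_ge1 q0 q1 ltr01 z0 z1.
have -> : qpoch z q = fun n => (qbin 0 q z)^-1 * qbin 0 q (q ^+ n * z).
  apply/funext => n.
  have := qbin_iter n q0 q1 ltr01 z0 z1; rewrite mul0r.
  rewrite {2}/qpoch big1 ?mul1r => [|i _]; last by rewrite mul0r subr0.
  by move=> <-; rewrite mulKf // gt_eqF // (lt_le_trans ltr01).
rewrite -[X in _ --> X]mulr1; apply: cvgMr; exact: cvg_qbin_near0.
Qed.

Lemma qpochoo01_gt0 q z : 0 < q -> q < 1 -> 0 < z -> z < 1 ->
  0 < qpochoo z q.
Proof.
move=> q0 q1 z0 z1; rewrite /qpochoo (cvg_lim _ (cvg_qpoch01 _ _ _ _)) //.
by rewrite invr_gt0 (lt_le_trans ltr01) // qbin_ge1.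
Qed.

Lemma cvg_qpoch c q z : 0 < q -> q < 1 -> c < 1 -> 0 < z -> z < 1 ->
  qpoch (c * z) q @ \oo --> qbin c q z * qpochoo z q.
Proof.
move=> q0 q1 c1 z0 z1.
have -> : qpoch (c * z) q
    = fun n => qbin c q z * (qpoch z q n * (qbin c q (q ^+ n * z))^-1).
  apply/funext => n; rewrite mulrA qbin_iter // mulfK // gt_eqF //.
  apply: lt_le_trans ltr01 _; apply: qbin_ge1 => //.
    by rewrite mulr_gt0 // exprn_gt0.
  have qn0 : 0 < q ^+ n by rewrite exprn_gt0.
  have qn1 : q ^+ n <= 1 by rewrite exprn_ile1 // ltW.
  nra.
rewrite -[qpochoo z q]mulr1; apply: cvgMr; apply: cvgM.
  rewrite /qpochoo (cvg_lim _ (cvg_qpoch01 _ _ _ _)) //; exact: cvg_qpoch01.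
rewrite -[X in _ --> X]invr1; apply: cvgV; first exact: oner_neq0.
exact: cvg_qbin_near0.
Qed.

Theorem q_binomial c q z : 0 < q -> q < 1 -> c < 1 -> 0 < z -> z < 1 ->
  qbin c q z = qpochoo (c * z) q / qpochoo z q.
Proof.
move=> q0 q1 c1 z0 z1; apply/esym.
rewrite {1}/qpochoo (cvg_lim _ (cvg_qpoch _ _ _ _ _)) // mulfK // gt_eqF //.
exact: qpochoo01_gt0.
Qed.

Lemma qpochoo_rec c q : cvgn (qpoch (c * q) q) ->
  qpochoo c q = (1 - c) * qpochoo (c * q) q.
Proof.
move=> cv; apply: cvg_lim => //; rewrite -cvg_shiftS.
under eq_cvg do rewrite /= qpochS.
exact: cvgMr.
Qed.

End QBinomial.

(** * Functionals given by their moments *)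

Section MomentFunctional.
Context {K : comNzRingType}.
Implicit Types (c : K) (mu : nat -> K) (f p : {poly K}).

Definition moment_fun mu f : K := \sum_(i < size f) f`_i * mu i.

Lemma moment_fun_wide mu n f : (size f <= n)%N ->
  moment_fun mu f = \sum_(i < n) f`_i * mu i.
Proof.
move=> fn; rewrite /moment_fun (big_ord_widen n (fun i => f`_i * mu i) fn).
rewrite [RHS](bigID (fun i : 'I_n => i < size f)%N) /=.
rewrite [X in _ + X]big1 ?addr0 // => i.
by rewrite -leqNgt => /(nth_default 0) ->; rewrite mul0r.
Qed.

Lemma moment_fun_is_linear mu : linear (moment_fun mu : {poly K} -> K^o).
Proof.
move=> c f p; pose n := maxn (size (c *: f + p)) (maxn (size f) (size p)).
have [fn pn sn] : [/\ (size f <= n)%N, (size p <= n)%N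
    & (size (c *: f + p)%R <= n)%N].
  by rewrite !leq_max !leqnn !orbT.
rewrite (moment_fun_wide _ fn) (moment_fun_wide _ pn) (moment_fun_wide _ sn).
rewrite scaler_sumr -big_split; apply: eq_bigr => i _ /=.
by rewrite coefD coefZ mulrDl -mulrA.
Qed.

HB.instance Definition _ mu := GRing.isLinear.Build K {poly K} K^o _
  (moment_fun mu : {poly K} -> K^o) (moment_fun_is_linear mu).

Lemma moment_funD mu f p :
  moment_fun mu (f + p) = moment_fun mu f + moment_fun mu p.
Proof. exact: (raddfD (moment_fun mu : {poly K} -> K^o)). Qed.

Lemma moment_funZ mu c f : moment_fun mu (c *: f) = c * moment_fun mu f.
Proof. exact: (linearZ_LR (moment_fun mu : {poly K} -> K^o)). Qed.

Lemma moment_funXn mu n : moment_fun mu 'X^n = mu n.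
Proof.
rewrite (@moment_fun_wide _ n.+1) ?size_polyXn // big_ord_recr /=.
rewrite coefXn eqxx mul1r big1 ?add0r // => i _.
by rewrite coefXn ltn_eqF // mul0r.
Qed.

End MomentFunctional.

(** * Monic little q-Jacobi polynomials *)

Section LittleQJacobi.
Context {R : realType}.
Implicit Types (a b c q : R) (n i j k : nat) (f g p : {poly R}).

Definition admissible a b q := [/\ 0 < q, q < 1, 0 < a, a * q < 1 & b * q < 1].

Lemma admissible_next a b q : admissible a b q -> admissible (a * q) (b * q) q.
Proof. by case=> q0 q1 a0 aq bq; split; rewrite // ?mulr_gt0 //; nra. Qed.

Lemma admissible_shift a b q : admissible a b q -> admissible (a * q ^+ 2) b q.
Proof.
case=> q0 q1 a0 aq bq; split; rewrite // ?mulr_gt0 ?exprn_gt0 //.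
by rewrite expr2; nra.
Qed.

Lemma admissible_a a b q k : admissible a b q -> 0 < 1 - a * q ^+ k.+1.
Proof.
case=> q0 q1 a0 aq bq; rewrite exprS subr_gt0.
have : 0 < q ^+ k by rewrite exprn_gt0.
have : q ^+ k <= 1 by rewrite exprn_ile1 // ltW.
by move: (q ^+ k) => u; nra.
Qed.

Lemma admissible_b a b q k : admissible a b q -> 0 < 1 - b * q ^+ k.+1.
Proof.
case=> q0 q1 a0 aq bq; rewrite exprS subr_gt0.
have : 0 < q ^+ k by rewrite exprn_gt0.
have : q ^+ k <= 1 by rewrite exprn_ile1 // ltW.
by move: (q ^+ k) => u; nra.
Qed.

(** The product [a b q] itself may reach or exceed 1, so the positivity starts
    at exponent 2. *)
Lemma admissible_ab a b q k : admissible a b q -> 0 < 1 - a * b * q ^+ k.+2.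
Proof.
case=> q0 q1 a0 aq bq; rewrite !exprS subr_gt0.
have u0 : 0 < q ^+ k by rewrite exprn_gt0.
have u1 : q ^+ k <= 1 by rewrite exprn_ile1 // ltW.
rewrite (_ : _ * _ = (a * q) * (b * q) * q ^+ k); last by ring.
have aq0 : 0 < a * q by rewrite mulr_gt0.
have : a * q * (b * q) < 1 by nra.
by move: (a * q * (b * q)) (q ^+ k) u0 u1 => x u; nra.
Qed.

Lemma admissible_q a b q k : admissible a b q -> 0 < 1 - q ^+ k.+1.
Proof. by case=> q0 q1 *; rewrite subr_gt0 exprn_ilt1 // ltW. Qed.

Definition moment a b q j : R :=
  qpochoo (a * b * q ^+ j.+2) q / qpochoo (a * q ^+ j.+1) q.

Lemma moment_qbin a b q j : admissible a b q ->
  moment a b q j = qbin (b * q) q (a * q ^+ j.+1).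
Proof.
move=> H; have [q0 q1 a0 aq bq] := H.
have := admissible_a j H; rewrite subr_gt0 => z1.
rewrite q_binomial ?mulr_gt0 ?exprn_gt0 //.
rewrite /moment (_ : b * q * _ = a * b * q ^+ j.+2) //.
by rewrite [q ^+ j.+2]exprS; ring.
Qed.

Lemma moment_gt0 a b q j : admissible a b q -> 0 < moment a b q j.
Proof.
move=> H; rewrite moment_qbin //; have [q0 q1 a0 aq bq] := H.
apply: lt_le_trans ltr01 _; apply: qbin_ge1; rewrite ?mulr_gt0 ?exprn_gt0 //.
by have := admissible_a j H; rewrite subr_gt0.
Qed.

Lemma qpochoo_shift_a a b q j : admissible a b q ->
  qpochoo (a * q ^+ j.+1) q = (1 - a * q ^+ j.+1) * qpochoo (a * q ^+ j.+2) q.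
Proof.
move=> H; have [q0 q1 a0 aq bq] := H.
rewrite [LHS]qpochoo_rec -mulrA -exprSr //.
apply/cvg_ex; eexists; apply: cvg_qpoch01 => //.
  exact: mulr_gt0 (exprn_gt0 _ q0).
by have := admissible_a j.+1 H; rewrite subr_gt0.
Qed.

Lemma qpochoo_shift_ab a b q j : admissible a b q ->
  qpochoo (a * b * q ^+ j.+2) q
    = (1 - a * b * q ^+ j.+2) * qpochoo (a * b * q ^+ j.+3) q.
Proof.
move=> H; have [q0 q1 a0 aq bq] := H.
rewrite [LHS]qpochoo_rec -(mulrA (a * b)) -exprSr //.
rewrite (_ : a * b * q ^+ j.+3 = b * q * (a * q ^+ j.+2)); last first.
  by rewrite [q ^+ j.+3]exprS; ring.
apply/cvg_ex; eexists; apply: cvg_qpoch => //.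
  exact: mulr_gt0 (exprn_gt0 _ q0).
by have := admissible_a j.+1 H; rewrite subr_gt0.
Qed.

Lemma qpochoo_a_gt0 a b q j : admissible a b q -> 0 < qpochoo (a * q ^+ j.+1) q.
Proof.
move=> H; have [q0 q1 a0 aq bq] := H.
apply: qpochoo01_gt0 => //.
  exact: mulr_gt0 (exprn_gt0 _ q0).
by have := admissible_a j H; rewrite subr_gt0.
Qed.

Lemma moment_next a b q j : admissible a b q ->
  moment a b q j.+1 = (1 - a * b * q ^+ j.+3) * moment (a * q) (b * q) q j.
Proof.
move=> H; rewrite /moment (qpochoo_shift_ab j.+1 H).
have -> : a * q * (b * q) * q ^+ j.+2 = a * b * q ^+ j.+4.
  by rewrite [q ^+ j.+4]exprS [q ^+ j.+3]exprS; ring.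
by rewrite -[a * q * _]mulrA -exprS -[LHS]mulrA.
Qed.

Lemma moment_rec a b q j : admissible a b q ->
  (1 - a * b * q ^+ j.+2) * moment a b q j.+1
    = (1 - a * q ^+ j.+1) * moment a b q j.
Proof.
move=> H; rewrite /moment (qpochoo_shift_ab j H) (qpochoo_shift_a j H).
have := qpochoo_a_gt0 j.+1 H; have := admissible_a j H.
move: (qpochoo (a * q ^+ j.+2) q) (1 - a * q ^+ j.+1) => x y y0 x0.
by field; rewrite !gt_eqF.
Qed.

(** The factor [y^2] turns the weight for [(a, b)] into the one for
    [(a q^2, b)]. *)
Lemma moment_shift a b q j :
  moment (a * q ^+ 2) b q j = moment a b q j.+2.
Proof.
have ea : a * q ^+ 2 * q ^+ j.+1 = a * q ^+ j.+3 by rewrite -mulrA -exprD.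
have eb : a * q ^+ 2 * b * q ^+ j.+2 = a * b * q ^+ j.+4.
  by rewrite (mulrAC a) -(mulrA (a * b)) -exprD.
by rewrite /moment ea eb.
Qed.

Definition qdilate (c : R) f : {poly R} := \poly_(i < size f) (c ^+ i * f`_i).

Lemma coef_qdilate c f i : (qdilate c f)`_i = c ^+ i * f`_i.
Proof.
by rewrite coef_poly; case: ltnP => // /(nth_default 0) ->; rewrite mulr0.
Qed.

(** The backward shift operator
    [f |-> a q (1 - b q y) f(y) - (1 - y) f(y / q)] of the little q-Jacobi
    polynomials. *)
Definition raise a b q f : {poly R} :=
  (a * q) *: (f - (b * q) *: ('X * f)) - (1 - 'X) * qdilate q^-1 f.

Lemma coef_raise a b q f i : (raise a b q f)`_i =
  (a * q - q^-1 ^+ i) * f`_i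
  + (if i is j.+1 then (q^-1 ^+ j - a * b * q ^+ 2) * f`_j else 0).
Proof.
rewrite /raise mulrBl mul1r !(coefB, coefZ) !coefXM !coef_qdilate.
by case: i => [|i] /=; ring.
Qed.

Lemma raiseP a b q c f g :
  raise a b q (c *: f + g) = c *: raise a b q f + raise a b q g.
Proof.
apply/polyP => i; rewrite coef_raise [RHS]coefD [in RHS]coefZ !coef_raise.
rewrite !coefD !coefZ.
by case: i => [|i]; rewrite ?coefD ?coefZ; ring.
Qed.

(** The q-derivative [f |-> (f(y) - f(q y)) / y], up to the factor [1 - q]. *)
Definition qdiff q f : {poly R} :=
  \poly_(i < (size f).-1) ((1 - q ^+ i.+1) * f`_i.+1).

Lemma coef_qdiff q f i : (qdiff q f)`_i = (1 - q ^+ i.+1) * f`_i.+1.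
Proof.
rewrite coef_poly; case: ltnP => // h.
by rewrite nth_default ?mulr0 // (leq_trans (leqSpred _)).
Qed.

Lemma qdiffP q c f g : qdiff q (c *: f + g) = c *: qdiff q f + qdiff q g.
Proof.
by apply/polyP => i; rewrite coefD coefZ !coef_qdiff coefD coefZ; ring.
Qed.

Lemma size_qdiff q f n : (size f <= n.+1)%N -> (size (qdiff q f) <= n)%N.
Proof.
move=> fn; apply/leq_sizeP => i ni.
by rewrite coef_qdiff nth_default ?mulr0 // (leq_trans fn).
Qed.

Definition jfun a b q f : R := moment_fun (moment a b q) f.

Lemma jfunD a b q f g :
  jfun a b q (f + g) = jfun a b q f + jfun a b q g.
Proof. exact: moment_funD. Qed.

Lemma jfunZ a b q (c : R) f :
  jfun a b q (c *: f) = c * jfun a b q f.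
Proof. exact: moment_funZ. Qed.

Lemma jfunXn a b q n : jfun a b q 'X^n = moment a b q n.
Proof. exact: moment_funXn. Qed.

Lemma linear_poly_ext (f g : {poly R} -> R) :
  (forall (c : R) (p r : {poly R}), f (c *: p + r) = c * f p + f r) ->
  (forall (c : R) (p r : {poly R}), g (c *: p + r) = c * g p + g r) ->
  (forall i, f 'X^i = g 'X^i) -> f =1 g.
Proof.
move=> fl gl fg.
have f0 : f 0 = 0.
  by have := fl 1 0 0; rewrite scaler0 addr0 mul1r; lra.
have g0 : g 0 = 0.
  by have := gl 1 0 0; rewrite scaler0 addr0 mul1r; lra.
move=> p; rewrite -(coefK p) poly_def.
elim/big_rec: _ => [|i r _ IHr]; first by rewrite f0 g0.
by rewrite fl gl fg IHr.
Qed.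

Lemma scale_polyl (c : R) f g : (c *: f) * g = c *: (f * g).
Proof. by rewrite scalerAl. Qed.

Lemma scale_polyr (c : R) f g : f * (c *: g) = c *: (f * g).
Proof. by rewrite scalerAr. Qed.

(** Both sides are bilinear, so it is enough to compare monomials; both vanish
    when [g] is constant, and otherwise each is a multiple of one single moment
    for [(a q, b q)]. *)
Lemma raise_adjoint a b q f g : admissible a b q ->
  jfun a b q (raise a b q f * g)
    = a * q * (1 - b * q) * jfun (a * q) (b * q) q (f * qdiff q g).
Proof.
move=> H; have [q0 q1 _ _ _] := H.
pose F (h : {poly R}) := jfun a b q (raise a b q h * g).
pose G (h : {poly R}) := a * q * (1 - b * q)
  * jfun (a * q) (b * q) q (h * qdiff q g).
apply: (@linear_poly_ext F G) => [c p r|c p r|i]; rewrite /F /G.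
- by rewrite raiseP mulrDl scale_polyl jfunD jfunZ.
- by rewrite mulrDl scale_polyl jfunD jfunZ; ring.
pose F' (h : {poly R}) := jfun a b q (raise a b q 'X^i * h).
pose G' (h : {poly R}) := a * q * (1 - b * q)
  * jfun (a * q) (b * q) q ('X^i * qdiff q h).
apply: (@linear_poly_ext F' G') => [c p r|c p r|j]; rewrite /F' /G'.
- by rewrite mulrDr scale_polyr jfunD jfunZ.
- by rewrite qdiffP (mulrDr 'X^i) scale_polyr jfunD jfunZ; ring.
have rX : raise a b q 'X^i = (a * q - q^-1 ^+ i) *: 'X^i
    + (q^-1 ^+ i - a * b * q ^+ 2) *: 'X^(i.+1).
  apply/polyP => k; rewrite coef_raise coefD !coefZ !coefXn.
  case: k => [|k]; rewrite ?eqSS ?mulr0 //.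
    by case: eqP => [<-|]; rewrite ?mulr0.
  by rewrite coefXn; congr (_ + _); case: eqP => [->|_]; rewrite ?mulr0.
have dX : qdiff q 'X^j = (1 - q ^+ j) *: 'X^(j.-1).
  apply/polyP => k; rewrite coef_qdiff coefZ !coefXn.
  case: j => [|j] /=; first by rewrite expr0 subrr mulr0 mul0r.
  by rewrite eqSS; case: eqP => [->|]; rewrite ?mulr0.
rewrite rX dX mulrDl !scale_polyl scale_polyr -!exprD jfunD !jfunZ.
rewrite !jfunXn addSn.
have qi0 : q ^+ i != 0 by rewrite expf_neq0 // gt_eqF.
rewrite exprVn.
case: j {rX dX} => [|j].
  rewrite expr0 subrr mul0r mulr0 addn0.
  have := moment_rec i H; rewrite [q ^+ i.+2]exprS [q ^+ i.+1]exprS.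
  move: (moment _ _ _ _) (moment _ _ _ _) => x y e.
  transitivity ((q ^+ i)^-1 * ((1 - a * b * (q * (q * q ^+ i))) * y
    - (1 - a * (q * q ^+ i)) * x)); last by rewrite e subrr mulr0.
  by field.
rewrite addnS /=.
have e1 := moment_next (i + j) H.
have e2 : moment a b q (i + j).+2
    = (1 - a * q ^+ (i + j).+2) * moment (a * q) (b * q) q (i + j).
  apply: (mulfI (lt0r_neq0 (admissible_ab (i + j).+1 H))).
  by rewrite moment_rec // e1 mulrCA.
rewrite e1 e2.
rewrite ![q ^+ (_ + _).+3]exprS ![q ^+ (_ + _).+2]exprS !(exprS q (i + j)).
by rewrite !(exprS q j) exprD; field.
Qed.

(** The factor in front normalizes the leading coefficient to 1. *)
Fixpoint lqj a b q n : {poly R} :=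
  if n is m.+1 then
    (q ^+ m / (1 - a * b * q ^+ m.+2)) *: raise a b q (lqj (a * q) (b * q) q m)
  else 1.

Fixpoint lqj_norm a b q n : R :=
  if n is m.+1 then
    a * q ^+ m.+1 * (1 - b * q) * (1 - q ^+ m.+1) / (1 - a * b * q ^+ m.+2)
    * lqj_norm (a * q) (b * q) q m
  else moment a b q 0.

Lemma lqjS a b q n : lqj a b q n.+1 =
  (q ^+ n / (1 - a * b * q ^+ n.+2)) *: raise a b q (lqj (a * q) (b * q) q n).
Proof. by []. Qed.

Lemma lqj_normS a b q n : lqj_norm a b q n.+1 =
  a * q ^+ n.+1 * (1 - b * q) * (1 - q ^+ n.+1) / (1 - a * b * q ^+ n.+2)
  * lqj_norm (a * q) (b * q) q n.
Proof. by []. Qed.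

Lemma size_lqj a b q n : (size (lqj a b q n) <= n.+1)%N.
Proof.
elim: n a b => [|n IHn] a b /=; first by rewrite size_poly1.
apply/leq_sizeP => i ni; rewrite coefZ coef_raise.
case: i ni => // i ni.
rewrite !(nth_default 0) ?mulr0 ?addr0 ?mulr0 // (leq_trans (IHn _ _)) //.
exact: ltnW.
Qed.

Lemma lead_lqj a b q n : admissible a b q -> (lqj a b q n)`_n = 1.
Proof.
elim: n a b => [|n IHn] a b H /=; first by rewrite coef1.
rewrite coefZ coef_raise (IHn _ _ (admissible_next H)).
rewrite (nth_default 0) ?size_lqj // mulr0 add0r mulr1.
have := admissible_ab n H; have [q0 _ _ _ _] := H.
have qn0 : 0 < q ^+ n by rewrite exprn_gt0.
rewrite exprVn !exprS => h; field; rewrite !gt_eqF //.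
Qed.

(** The second coefficient is what enters [alpha]. *)
Lemma subleading_lqj a b q n : admissible a b q ->
  (lqj a b q n.+1)`_n = - ((1 - q ^+ n.+1) * (1 - a * q ^+ n.+1)
    / ((1 - q) * (1 - a * b * q ^+ (2 * n.+1)))).
Proof.
elim: n a b => [|n IHn] a b H.
  rewrite /= coefZ coef_raise coef1 /= !expr0 addr0 mulr1 muln1.
  have := admissible_ab 0 H; have := admissible_q 0 H; rewrite expr1 => h h'.
  by field; rewrite !gt_eqF.
rewrite lqjS coefZ coef_raise lead_lqj; last exact: admissible_next.
rewrite IHn; last exact: admissible_next.
have h1 := admissible_ab n.+1 H.
have h2 : 0 < 1 - a * b * (q ^+ n.+2) ^+ 2.
  by rewrite -exprM mulnC mulSn; exact: admissible_ab.
have := admissible_q 0 H; rewrite expr1 => h3.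
have [q0 _ _ _ _] := H.
have qn0 : 0 < q ^+ n by rewrite exprn_gt0.
rewrite !(mulnC 2%N) !exprM.
move: h1 h2; rewrite !exprVn !exprS !expr0 !mulr1.
move: (q ^+ n) qn0 => u u0 h1 h2.
field; rewrite !gt_eqF //.
Qed.

(** Orthogonality and norm in one statement: each step moves one raising
    operator from [lqj] to a q-derivative on [g], which lowers both degrees, so
    that only the top coefficient of [g] survives. *)
Lemma jfun_lqj a b q n g : admissible a b q -> (size g <= n.+1)%N ->
  jfun a b q (lqj a b q n * g) = g`_n * lqj_norm a b q n.
Proof.
elim: n a b g => [|n IHn] a b g H gn.
  have e : g = g`_0 *: 'X^0 by rewrite expr0 alg_polyC -size1_polyC.
  by rewrite /= mul1r {1}e jfunZ jfunXn.
rewrite lqjS scale_polyl jfunZ raise_adjoint //.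
rewrite IHn ?size_qdiff //; last exact: admissible_next.
by rewrite coef_qdiff lqj_normS !(exprS q n); ring.
Qed.

Lemma lqj_norm_gt0 a b q n : admissible a b q -> 0 < lqj_norm a b q n.
Proof.
elim: n a b => [|n IHn] a b H; first exact: moment_gt0.
rewrite lqj_normS mulr_gt0 ?IHn //; last exact: admissible_next.
have [q0 q1 a0 aq bq] := H.
by rewrite divr_gt0 ?(admissible_ab n H) // !mulr_gt0 ?exprn_gt0 ?subr_gt0 //
   -subr_gt0 (admissible_q n H).
Qed.

(** This is the quotient of the norms in [lqj_norm_ratio], and the coefficient
    of [`|v| ^+ 2] in the definition of [xi]. *)
Definition norm_ratio a b q n : R := a * q
  * ((1 - q ^+ n) * (1 - b * q ^+ n)
     / ((1 - a * b * q ^+ n.+1) * (1 - a * q ^+ n.+1))).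

Lemma lqj_norm_ratio a b q n : admissible a b q ->
  lqj_norm a b q n.+1
    = norm_ratio a b q n.+1 * lqj_norm (a * q ^+ 2) b q n.
Proof.
elim: n a b => [|n IHn] a b H.
  rewrite lqj_normS /= moment_shift (moment_next 1 H) /norm_ratio.
  have H1 := admissible_next H.
  have e : (1 - a * b * q ^+ 4) * moment (a * q) (b * q) q 1
      = (1 - a * q ^+ 2) * moment (a * q) (b * q) q 0.
    have := moment_rec 0 H1.
    have -> : a * q * (b * q) * q ^+ 2 = a * b * q ^+ 4 by ring.
    by have -> : a * q * q ^+ 1 = a * q ^+ 2 by ring.
  rewrite e.
  have := admissible_ab 0 H; have := admissible_a 1 H.
  rewrite expr1 => h1 h2; field; rewrite !gt_eqF //.
have H1 := admissible_next H.
rewrite lqj_normS IHn // lqj_normS (mulrAC a (q ^+ 2) q) /norm_ratio.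
have h1 := admissible_ab n.+1 H; have h2 := admissible_ab n.+2 H.
have h3 := admissible_a n.+2 H; have h4 := admissible_q n H.
have [q0 _ _ _ _] := H; have qn0 : 0 < q ^+ n by rewrite exprn_gt0.
move: h1 h2 h3 h4; rewrite !exprS !expr0 !mulr1.
move: (q ^+ n) qn0 (lqj_norm _ _ _ _) => u u0 N h1 h2 h3 h4.
have h2' : 0 < 1 - a * (q * q) * b * (q * (q * u)).
  rewrite (_ : _ * (q * (q * u)) = a * b * (q * (q * (q * (q * u))))) //.
  by ring.
by field; rewrite !gt_eqF.
Qed.

Lemma hfrac0 a b q : hfrac a b q 0 = 1.
Proof.
rewrite /hfrac; case: ifPn => // h.
by rewrite muln0 add0n expr1 qpoch0 mulr1 divff.
Qed.

(** Both branches of [hfrac] agree in positive degree, since [1 - a b q] is the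
    first factor of [qpoch (a * b * q) q n.+1]. *)
Lemma hfracS a b q n : hfrac a b q n.+1
  = ((1 - a * b * q ^+ (2 * n.+1 + 1)) * qpoch (a * b * q ^+ 2) q n)^-1.
Proof.
rewrite /hfrac; case: ifPn => [_|h]; first by rewrite div1r.
rewrite qpochS -[a * b * q * q]mulrA -expr2 mulrCA invfM mulrA divff //.
by rewrite mul1r.
Qed.

Lemma hfrac_step a b q n : admissible a b q ->
  hfrac a b q n.+1 * ((1 - a * b * q ^+ 2) * (1 - a * b * q ^+ 3))
    = (1 - a * b * q ^+ n.+2) * hfrac (a * q) (b * q) q n.
Proof.
move=> H; rewrite hfracS.
have h2 := admissible_ab 0 H; have h3 := admissible_ab 1 H.
case: n => [|n].
  by rewrite hfrac0 qpoch0 !mulr1 muln1 mulrC mulfK // gt_eqF.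
rewrite hfracS.
have -> : a * q * (b * q) * q ^+ (2 * n.+1 + 1) = a * b * q ^+ (2 * n.+2 + 1).
  by rewrite !mulnS !addSn !exprS; ring.
have -> : a * q * (b * q) * q ^+ 2 = a * b * q ^+ 4 by ring.
have p3 : 0 < 1 - a * b * q ^+ (2 * n.+2 + 1).
  by rewrite !mulnS !addSn; exact: admissible_ab.
have p4 : 0 < qpoch (a * b * q ^+ 4) q n.
  have [q0 q1 _ _ _] := H; apply: qpoch_gt0 => //.
  by rewrite -subr_gt0; exact: admissible_ab H.
have p2 : 0 < qpoch (a * b * q ^+ 2) q n.+1.
  have [q0 q1 _ _ _] := H; apply: qpoch_gt0 => //.
  by rewrite -subr_gt0; exact: admissible_ab H.
have e : qpoch (a * b * q ^+ 2) q n.+1 * (1 - a * b * q ^+ n.+3)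
    = (1 - a * b * q ^+ 2) * (1 - a * b * q ^+ 3) * qpoch (a * b * q ^+ 4) q n.
  have -> : a * b * q ^+ n.+3 = a * b * q ^+ 2 * q ^+ n.+1.
    by rewrite -(mulrA (a * b)) -exprD.
  by rewrite -qpochSr !qpochS -!(mulrA (a * b)) -!exprSr mulrA.
move: e p2 p3 p4; move: (qpoch _ _ _) (qpoch _ _ _) (1 - a * b * q ^+ (_ + _)).
move=> x y z e y0 z0 x0.
rewrite -[X in _ * X = _](mulfK (lt0r_neq0 x0)) -e.
by field; rewrite !gt_eqF.
Qed.

(** Up to the sign [(-1) ^+ n], the inverse of the leading coefficient of the
    little q-Jacobi polynomial normalized to take the value 1 at 0, whose
    squared norm is [hnorm]. *)
Definition inv_lead a b q n : R :=
  q ^+ 'C(n, 2) * (qpoch (a * q) q n / qpoch (a * b * q ^+ n.+1) q n).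

Lemma inv_lead_step a b q n : admissible a b q ->
  inv_lead a b q n.+1 = q ^+ n * (1 - a * q) / (1 - a * b * q ^+ n.+2)
    * inv_lead (a * q) (b * q) q n.
Proof.
move=> H; rewrite /inv_lead binS bin1 exprD !qpochS.
have -> : a * q * (b * q) * q ^+ n.+1 = a * b * q ^+ n.+3.
  by rewrite !exprS; ring.
rewrite -(mulrA (a * b)) -exprSr invfM; ring.
Qed.

Lemma hnorm_step a b q n : admissible a b q ->
  hnorm a b q n.+1 = a * q * (1 - a * b * q ^+ n.+2) * (1 - q ^+ n.+1)
    * (1 - b * q) / (q ^+ n * (1 - a * q) ^+ 2) * hnorm (a * q) (b * q) q n.
Proof.
move=> H; have H1 := admissible_next H.
have h2 := admissible_ab 0 H; have h3 := admissible_ab 1 H.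
have ha := admissible_a 0 H; have [q0 q1 a0 aq bq] := H.
have qn0 : 0 < q ^+ n by rewrite exprn_gt0.
have ea : qpochoo (a * q) q = (1 - a * q) * qpochoo (a * q * q) q.
  by have := qpochoo_shift_a 0 H; rewrite expr1 expr2 mulrA.
have eb : qpochoo (a * b * q ^+ 2) q = (1 - a * b * q ^+ 2)
    * (1 - a * b * q ^+ 3) * qpochoo (a * q * (b * q) * q ^+ 2) q.
  have -> : a * q * (b * q) * q ^+ 2 = a * b * q ^+ 4 by ring.
  by rewrite (qpochoo_shift_ab 0 H) (qpochoo_shift_ab 1 H) mulrA.
have ef : hfrac a b q n.+1 = (1 - a * b * q ^+ n.+2)
    * hfrac (a * q) (b * q) q n / ((1 - a * b * q ^+ 2) * (1 - a * b * q ^+ 3)).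
  by rewrite -hfrac_step // mulfK // mulf_neq0 // gt_eqF.
rewrite /hnorm ea eb ef qpochSr (qpochS (b * q)) (qpochS (a * q)) -exprS.
rewrite [(a * q) ^+ n.+1]exprS [(a * q * q) ^+ n]exprMn.
have p1 : 0 < qpoch (a * q * q) q n.
  by apply: qpoch_gt0 => //; case: H1.
have p2 : 0 < qpochoo (a * q * q) q.
  by have := qpochoo_a_gt0 0 H1; rewrite expr1.
move: ha h2 h3 p1 p2 qn0; rewrite expr1.
move: (qpochoo _ _) (qpochoo _ _) (qpoch _ _ _) (qpoch _ _ _) (qpoch _ _ _).
move: (q ^+ n) ((a * q) ^+ n) (hfrac _ _ _ _) => *.
field.
by rewrite !gt_eqF.
Qed.

(** Both sides obey the same recursion under
    [(a, b, n.+1) -> (a q, b q, n)]. *)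
Lemma hnorm_lqj a b q n : admissible a b q ->
  inv_lead a b q n ^+ 2 * hnorm a b q n = lqj_norm a b q n.
Proof.
elim: n a b => [|n IHn] a b H.
  rewrite /inv_lead /hnorm hfrac0 !qpoch0 !expr0 !divr1 !mulr1 expr1n mul1r.
  by rewrite /= /moment expr1.
have H1 := admissible_next H.
rewrite inv_lead_step // hnorm_step // lqj_normS -IHn //.
have h2 := admissible_ab n H.
have ha := admissible_a 0 H; have [q0 q1 a0 aq bq] := H.
have qn0 : 0 < q ^+ n by rewrite exprn_gt0.
move: ha h2 qn0; rewrite expr1 !exprS expr0 !mulr1.
move: (q ^+ n) (hnorm _ _ _ _) (inv_lead _ _ _ _) => *.
by field; rewrite !gt_eqF.
Qed.

End LittleQJacobi.

(** * Summation of complex polynomials against the weight *)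

Section ComplexSeries.
Context {R : realType}.
Local Notation C := R[i].
Implicit Types (a b q : R) (c w : C) (f g T : {poly C}).

Lemma cvg_real_complex (u : R^nat) (l : R) : u @ \oo --> l ->
  (fun n => (u n)%:C : (C : numFieldType)) @ \oo
    --> (l%:C : (C : numFieldType)).
Proof.
move=> /cvgrPdist_lt ul; apply/cvgrPdist_lt => e e0.
have eE : (complex.Re e)%:C = e by apply: RRe_real; exact: gtr0_real.
have re0 : 0 < complex.Re e by rewrite -ltcR eE.
have := ul _ re0; apply: filterS => n un.
by rewrite -rmorphB -eE normc_def /= expr0n /= addr0 sqrtr_sqr ltcR.
Qed.

(** The complex-linear extension of [jfun]. *)
Definition cjfun a b q T : C := moment_fun (fun j => (moment a b q j)%:C) T.

Lemma cjfunE a b q T :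
  cjfun a b q T = \sum_(j < size T) T`_j * (moment a b q j)%:C.
Proof. by []. Qed.

Lemma cjfunD a b q f g : cjfun a b q (f + g) = cjfun a b q f + cjfun a b q g.
Proof. exact: moment_funD. Qed.

Lemma cjfunZ a b q c f : cjfun a b q (c *: f) = c * cjfun a b q f.
Proof. exact: moment_funZ. Qed.

Definition lqj_weight a b q n : R :=
  (a * q) ^+ n * (qpoch (b * q) q n / qpoch q q n).

(** Expanding [T] into monomials turns the sum into finitely many q-binomial
    series, one for each moment. *)
Lemma cvg_series_lqj_weight a b q T : admissible a b q ->
  series (fun x =>
      (lqj_weight a b q x)%:C * T.[(q ^+ x)%:C] : (C : numFieldType)) @ \oo
    --> (cjfun a b q T : (C : numFieldType)).
Proof.
move=> H; have [q0 q1 a0 aq bq] := H.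
have cv j : (fun n =>
      (qbin_sum (b * q) q (a * q ^+ j.+1) n)%:C : (C : numFieldType)) @ \oo
    --> ((moment a b q j)%:C : (C : numFieldType)).
  apply: cvg_real_complex; rewrite moment_qbin //.
  apply: cvg_qbin => //; first exact: mulr_gt0 (exprn_gt0 _ q0).
  by have := admissible_a j H; rewrite subr_gt0.
have -> : series (fun x =>
      (lqj_weight a b q x)%:C * T.[(q ^+ x)%:C] : (C : numFieldType))
    = fun n =>
      \sum_(j < size T) T`_j * (qbin_sum (b * q) q (a * q ^+ j.+1) n)%:C.
  apply/funext => n; rewrite /series /=.
  under [RHS]eq_bigr do rewrite /qbin_sum /series /= rmorph_sum mulr_sumr.
  rewrite exchange_big; apply: eq_bigr => x _.
  rewrite horner_coef mulr_sumr; apply: eq_bigr => j _.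
  rewrite mulrCA; congr (_ * _).
  rewrite -rmorphXn -rmorphM /lqj_weight /qbin_term; congr (_%:C).
  rewrite mulrAC mulrC; congr (_ * _).
  by rewrite -exprM mulnC exprM -exprMn; congr (_ ^+ _); rewrite exprS mulrA.
rewrite cjfunE; apply: cvg_big => [|j _]; first exact: add_continuous.
by apply: cvgMr; exact: cv.
Qed.

Lemma cvg_mx2 (u : nat -> 'M[C : numFieldType]_2) (M : 'M[C : numFieldType]_2) :
  (forall i j, (fun n => u n i j) @ \oo --> M i j) -> u @ \oo --> M.
Proof.
move=> uM; rewrite (matrix_sum_delta M).
have -> : u = fun n => \sum_(i < 2) \sum_(j < 2) u n i j *: delta_mx i j.
  by apply/funext => n; exact: matrix_sum_delta.
apply: cvg_big => [|i _]; first exact: add_continuous.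
apply: cvg_big => [|j _]; first exact: add_continuous.
exact: cvgZr_tmp.
Qed.
End ComplexSeries.

(** * Two-by-two matrices *)

Section TwoByTwo.
Context {K : pzRingType}.
Implicit Types (x y z t : K) (M N : 'M[K]_2).

Lemma mx2E x y z t i j : mx2 x y z t i j =
  if i == 0 then if j == 0 then x else y else if j == 0 then z else t.
Proof. by rewrite mxE. Qed.

Lemma sum_ord2 (F : 'I_2 -> K) : \sum_i F i = F 0 + F 1.
Proof.
by rewrite !big_ord_recl big_ord0 addr0; congr (_ + F _); exact/val_inj.
Qed.

Lemma mx2P M N : M 0 0 = N 0 0 -> M 0 1 = N 0 1 -> M 1 0 = N 1 0 ->
  M 1 1 = N 1 1 -> M = N.
Proof.
move=> h00 h01 h10 h11; apply/matrixP => i j.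
have cases (k : 'I_2) : k = 0 \/ k = 1.
  by case: k => [[|[|//]]] lt; [left|right]; exact/val_inj.
by case: (cases i) => ->; case: (cases j) => ->.
Qed.

Lemma mx2_mul x y z t x' y' z' t' : mx2 x y z t *m mx2 x' y' z' t'
  = mx2 (x * x' + y * z') (x * y' + y * t') (z * x' + t * z') (z * y' + t * t').
Proof. by apply: mx2P; rewrite !mxE sum_ord2 !mx2E. Qed.

End TwoByTwo.

(** * Decoupling the matrix inner product *)

Section InnerProduct.
Local Open Scope sesquilinear_scope.
Context {R : realType}.
Local Notation C := R[i].
Variables (a b q : R) (v : C).
Hypothesis H : admissible a b q.
Implicit Types (P Q : {poly 'M[C]_2}) (i j k n x : nat) (r s : 'I_2) (c : C).

Lemma Amx_exp x : Amx q v ^+ x =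
  mx2 (q ^+ x)%:C (- v * (1 - q ^+ x)%:C) 0 1.
Proof.
elim: x => [|x IHx].
  by rewrite !expr0 subrr mulr0; apply: mx2P; rewrite !mxE.
rewrite exprS IHx -mulmxE /Amx mx2_mul.
congr mx2; rewrite ?mulr0 ?mul0r ?addr0 ?add0r ?mulr1 //.
  by rewrite -rmorphM -exprS.
by rewrite exprS !rmorphB !rmorphM /= rmorph1; ring.
Qed.

Lemma adjE (M : 'M[C]_2) r s : M ^t* r s = Num.conj (M s r).
Proof. by rewrite !mxE. Qed.

Lemma adj_exp (M : 'M[C]_2) x : (M ^t*) ^+ x = (M ^+ x) ^t*.
Proof.
elim: x => [|x IHx]; first by rewrite !expr0 trmx1 map_mx1.
by rewrite exprS exprSr IHx -!mulmxE trmx_mul map_mxM.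
Qed.

Definition entry P r s : {poly C} := \poly_(i < size P) P`_i r s.

Lemma coef_entry P r s i : (entry P r s)`_i = P`_i r s.
Proof.
by rewrite coef_poly; case: ltnP => // /(nth_default 0) ->; rewrite mxE.
Qed.

Lemma size_entry P r s : (size (entry P r s) <= size P)%N.
Proof. exact: size_poly. Qed.

Lemma horner_entry P c r s : P.[c%:M] r s = (entry P r s).[c].
Proof.
rewrite horner_coef summxE horner_poly; apply: eq_bigr => i _.
have -> : (c%:M : 'M[C]_2) ^+ i = (c ^+ i)%:M.
  by rewrite -(rmorphXn (@scalar_mx C 2)).
by rewrite -mulmxE mul_mx_scalar mxE mulrC.
Qed.

(** Row [r] of [P(y) A^x] is [(y * wrow1 P r, wrow2 P r)] at [y = q^x]. *)
Definition wrow1 P r : {poly C} := entry P r 0.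
Definition wrow2 P r : {poly C} := entry P r 1 - v *: ((1 - 'X) * entry P r 0).

Definition ipform P Q r s : C :=
  cjfun (a * q ^+ 2) b q (wrow1 P r * map_poly Num.conj (wrow1 Q s))
  + cjfun a b q (wrow2 P r * map_poly Num.conj (wrow2 Q s)).

Lemma cjfun_shift (T : {poly C}) :
  cjfun (a * q ^+ 2) b q T = cjfun a b q ('X^2 * T).
Proof.
rewrite cjfunE /cjfun (@moment_fun_wide _ _ (size T).+2); last first.
  by rewrite (leq_trans (size_polyMleq _ _)) // size_polyXn.
rewrite !big_ord_recl !coefXnM /= !mul0r !add0r.
by apply: eq_bigr => i _; rewrite coefXnM /= !subSS subn0 moment_shift.
Qed.

Lemma conj_horner_real (T : {poly C}) (y : R) :
  Num.conj T.[y%:C] = (map_poly Num.conj T).[y%:C].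
Proof.
have yR : Num.conj y%:C = y%:C by exact: conjc_real.
by rewrite -{2}yR horner_map.
Qed.

(** Up to a scalar the weight is [A^x (A^x)^*], so each entry is the product of
    two rows of the form described at [wrow1]. *)
Lemma ip_term_entry P Q x r s : ip_term a b q v P Q x r s
  = (lqj_weight a b q x)%:C
    * ('X^2 * (wrow1 P r * map_poly Num.conj (wrow1 Q s))
       + wrow2 P r * map_poly Num.conj (wrow2 Q s)).[(q ^+ x)%:C].
Proof.
pose y := (q ^+ x)%:C : C.
have PA (P' : {poly 'M[C]_2}) r' :
    ((P'.[y%:M] *m Amx q v ^+ x) r' 0 = y * (wrow1 P' r').[y])
    * ((P'.[y%:M] *m Amx q v ^+ x) r' 1 = (wrow2 P' r').[y]).
  rewrite Amx_exp !mxE !sum_ord2 !mx2E !horner_entry /wrow1 /wrow2 /=.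
  rewrite !hornerE; split; rewrite ?rmorphB /= ?rmorph1; rewrite -/y; ring.
have -> : ip_term a b q v P Q x = (lqj_weight a b q x)%:C *:
   ((P.[y%:M] *m Amx q v ^+ x) *m (Q.[y%:M] *m Amx q v ^+ x) ^t*).
  rewrite /ip_term /weight adj_exp -/y trmx_mul map_mxM !mulmxA.
  rewrite -scalemxAr -scalemxAl scalerA !mulmxA; congr (_ *: _).
  by rewrite /lqj_weight /y -rmorphM; congr (_%:C); rewrite exprMn; ring.
rewrite mxE [X in _ * X]mxE sum_ord2 !adjE !PA.
have yR : Num.conj y = y by exact: conjc_real.
rewrite !rmorphM /= !conj_horner_real yR -/y.
move: (wrow1 P r) (wrow2 P r) (wrow1 Q s) (wrow2 Q s) => f1 f2 g1 g2.
rewrite hornerD (hornerM 'X^2) (hornerM f1) (hornerM f2) hornerXn -/y expr2.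
congr (_ * _); ring.
Qed.

Theorem ip_cvg P Q :
  ip_partial a b q v P Q @ \oo
    --> (\matrix_(r, s) ipform P Q r s : 'M[C : numFieldType]_2).
Proof.
apply: cvg_mx2 => r s; rewrite mxE /ipform cjfun_shift -cjfunD.
have -> : (fun n => ip_partial a b q v P Q n r s)
    = series (fun x => (lqj_weight a b q x)%:C
      * ('X^2 * (wrow1 P r * map_poly Num.conj (wrow1 Q s))
         + wrow2 P r * map_poly Num.conj (wrow2 Q s)).[(q ^+ x)%:C]).
  apply/funext => n; rewrite /ip_partial /series /= summxE.
  by apply: eq_bigr => x _; rewrite ip_term_entry.
exact: cvg_series_lqj_weight.
Qed.

Lemma ipE P Q : ip a b q v P Q = \matrix_(r, s) ipform P Q r s.
Proof.
rewrite /ip; have := @ip_cvg P Q; set M := (X in _ --> X) => h.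
by apply: cvg_lim h; exact: norm_hausdorff.
Qed.

Lemma is_cvg_ip P Q : cvgn (ip_partial a b q v P Q).
Proof. by apply/cvg_ex; eexists; exact: ip_cvg. Qed.

End InnerProduct.

(** * Sesquilinearity and the complex-linear extension *)

Section Sesquilinear.
Local Open Scope sesquilinear_scope.
Context {R : realType}.
Local Notation C := R[i].
Variables (a b q : R) (v : C).
Hypothesis H : admissible a b q.
Implicit Types (P Q S : {poly 'M[C]_2}) (M : 'M[C]_2) (f g T : {poly C})
  (i j k n : nat) (r s : 'I_2) (c : C).

Local Notation cj := (map_poly Num.conj).

Lemma scale_cpolyl c f g : (c *: f) * g = c *: (f * g).
Proof. by rewrite scalerAl. Qed.

Lemma scale_cpolyr c f g : f * (c *: g) = c *: (f * g).
Proof. by rewrite scalerAr. Qed.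

Lemma cj_scale c f : cj (c *: f) = Num.conj c *: cj f.
Proof. by apply/polyP => i; rewrite coefZ !coef_map coefZ /= rmorphM. Qed.

Lemma cjK f : cj (cj f) = f.
Proof. by apply/polyP => i; rewrite !coef_map /= conjCK. Qed.

Lemma conj_cjfun a' b' T : Num.conj (cjfun a' b' q T) = cjfun a' b' q (cj T).
Proof.
rewrite !cjfunE size_map_poly rmorph_sum; apply: eq_bigr => i _.
rewrite coef_map rmorphM; congr (_ * _); exact: conjc_real.
Qed.

Lemma wrow1_lin M P Q r : wrow1 (M *: P + Q) r
  = M r 0 *: wrow1 P 0 + M r 1 *: wrow1 P 1 + wrow1 Q r.
Proof.
apply/polyP => i; rewrite /wrow1 !coefD !coefZ !coef_entry coefD coefZ.
by rewrite mxE -mulmxE mxE sum_ord2.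
Qed.

Lemma wrow2_lin M P Q r : wrow2 v (M *: P + Q) r
  = M r 0 *: wrow2 v P 0 + M r 1 *: wrow2 v P 1 + wrow2 v Q r.
Proof.
have e s : entry (M *: P + Q) r s
    = M r 0 *: entry P 0 s + M r 1 *: entry P 1 s + entry Q r s.
  apply/polyP => i; rewrite !coefD !coefZ !coef_entry coefD coefZ.
  by rewrite mxE -mulmxE mxE sum_ord2.
by rewrite /wrow2 !e -!mul_polyC; ring.
Qed.

Lemma ip_lin M P Q S : ip a b q v (M *: P + Q) S
  = M *m ip a b q v P S + ip a b q v Q S.
Proof.
apply/matrixP => r s.
rewrite [RHS]mxE [(_ *m _) r s]mxE sum_ord2 !ipE // !mxE /ipform.
rewrite wrow1_lin wrow2_lin.
move: (wrow2 v P 0) (wrow2 v P 1) (wrow2 v Q r) (wrow2 v S s) => f0 f1 f g.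
by rewrite !mulrDl !cjfunD !scale_cpolyl !cjfunZ; ring.
Qed.

Lemma ipZl M P Q : ip a b q v (M *: P) Q = M *m ip a b q v P Q.
Proof.
have := ip_lin M P 0 Q; rewrite addr0 => ->.
have /eqP := ip_lin (-1) 0 0 Q.
rewrite scaler0 addr0 mulNmx mul1mx addNr => /eqP ->.
by rewrite addr0.
Qed.

Lemma ip_adj P Q : ip a b q v Q P = (ip a b q v P Q) ^t*.
Proof.
apply/matrixP => r s; rewrite !ipE // adjE !mxE /ipform.
move: (wrow1 P s) (wrow2 v P s) (wrow1 Q r) (wrow2 v Q r) => f1 f2 g1 g2.
rewrite rmorphD /= !conj_cjfun.
rewrite !rmorphM /= !cjK.
by congr (cjfun _ _ _ _ + cjfun _ _ _ _); rewrite mulrC.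
Qed.

Lemma ipZr M P Q : ip a b q v P (M *: Q) = ip a b q v P Q *m M ^t*.
Proof. by rewrite ip_adj ipZl trmx_mul map_mxM -ip_adj. Qed.

Definition cpoly (f : {poly R}) : {poly C} := map_poly (real_complex R) f.

Lemma coef_cpoly (f : {poly R}) i : (cpoly f)`_i = (f`_i)%:C.
Proof. exact: coef_map. Qed.

Lemma cj_cpoly (f : {poly R}) : cj (cpoly f) = cpoly f.
Proof.
by apply/polyP => i; rewrite coef_map !coef_cpoly; exact: conjc_real.
Qed.

Lemma cjfun_cpoly a' b' (f : {poly R}) :
  cjfun a' b' q (cpoly f) = (jfun a' b' q f)%:C.
Proof.
rewrite cjfunE size_map_poly /jfun rmorph_sum.
by apply: eq_bigr => i _; rewrite coef_cpoly [RHS]rmorphM.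
Qed.

Lemma cjfun_lqj a' b' n T : admissible a' b' q -> (size T <= n.+1)%N ->
  cjfun a' b' q (cpoly (lqj a' b' q n) * T) = T`_n * (lqj_norm a' b' q n)%:C.
Proof.
move=> H' Tn.
have -> : T = \sum_(j < n.+1) T`_j *: 'X^j.
  rewrite -poly_def; apply/polyP => j; rewrite coef_poly; case: ltnP => // nj.
  by rewrite nth_default // (leq_trans Tn).
have cf0 : cjfun a' b' q 0 = 0 by rewrite cjfunE size_poly0 big_ord0.
have cfX j : (j <= n)%N -> cjfun a' b' q (cpoly (lqj a' b' q n) * 'X^j)
    = (n == j)%:R * (lqj_norm a' b' q n)%:C.
  move=> jn; rewrite -(map_polyXn (real_complex R)) -[_ * _]rmorphM /=.
  rewrite cjfun_cpoly.
  by rewrite jfun_lqj ?size_polyXn // coefXn rmorphM rmorph_nat.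
rewrite mulr_sumr (big_morph _ (cjfunD a' b' q) cf0) big_ord_recr /=.
rewrite big1 ?add0r => [|j _]; last first.
  by rewrite scale_cpolyr cjfunZ cfX ?gtn_eqF ?mul0r ?mulr0 // ltnW.
rewrite scale_cpolyr cjfunZ cfX // eqxx mul1r; congr (_ * _).
rewrite coef_sum big_ord_recr /= coefZ coefXn eqxx mulr1 big1 ?add0r // => j _.
by rewrite coefZ coefXn gtn_eqF ?mulr0.
Qed.

Lemma cjfun_lqj_lqj a' b' m n : admissible a' b' q ->
  cjfun a' b' q (cpoly (lqj a' b' q m) * cpoly (lqj a' b' q n))
    = (m == n)%:R * (lqj_norm a' b' q n)%:C.
Proof.
move=> H'; wlog mn : m n / (n <= m)%N.
  move=> h; have [mn|nm] := leqP n m; first exact: h.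
  rewrite [X in cjfun _ _ _ X]mulrC (h n m (ltnW nm)) eq_sym.
  by case: eqP => [->|_]; rewrite ?mul0r.
rewrite cjfun_lqj //; last first.
  by rewrite size_map_poly (leq_trans (size_lqj _ _ _ _)).
rewrite coef_cpoly; case: eqP => [->|/eqP nm]; first by rewrite lead_lqj.
have -> : (lqj a' b' q n)`_m = 0.
  apply: nth_default; apply: leq_trans (size_lqj _ _ _ _) _.
  by rewrite ltn_neqAle eq_sym nm.
by rewrite rmorph0 !mul0r.
Qed.

End Sesquilinear.

Arguments lqj_norm : simpl never.

(** * The matrix-valued family and its norms *)

Section MatrixFamily.
Local Open Scope sesquilinear_scope.
Context {R : realType}.
Local Notation C := R[i].
Variables (a b q : R) (v : C).
Hypothesis H : admissible a b q.
Implicit Types (P Q S D : {poly 'M[C]_2}) (M : 'M[C]_2) (f g T : {poly C})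
  (i j k n : nat) (r s : 'I_2) (c : C).

Local Notation cj := (map_poly Num.conj).

Lemma norm_ratio0 : norm_ratio a b q 0 = 0.
Proof. by rewrite /norm_ratio !expr0 subrr !mul0r mulr0. Qed.

Lemma norm_ratio_ge0 n : 0 <= norm_ratio a b q n.
Proof.
case: n => [|n]; first by rewrite norm_ratio0.
have [q0 q1 a0 aq bq] := H.
have := admissible_a n.+1 H; have := admissible_ab n H.
have := admissible_q n H; have := admissible_b n H => *.
by rewrite /norm_ratio ltW // !(divr_gt0, mulr_gt0).
Qed.

Lemma xi_denom_ge1 n : 1 <= 1 + `|v| ^+ 2 * (norm_ratio a b q n)%:C.
Proof. by rewrite lerDl mulr_ge0 ?exprn_ge0 // ler0c norm_ratio_ge0. Qed.

Lemma real_complexM (x y : R) : (x * y)%:C = x%:C * y%:C :> C.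
Proof. by rewrite rmorphM. Qed.

Lemma xiE n : xi a b q v n = (1 + `|v| ^+ 2 * (norm_ratio a b q n)%:C)^-1.
Proof.
rewrite /xi /norm_ratio (real_complexM (a * q)) [in RHS]mulrA.
by rewrite (mulrC (`|v| ^+ 2)).
Qed.

Lemma xi_gt0 n : 0 < xi a b q v n.
Proof. by rewrite xiE invr_gt0 (lt_le_trans ltr01) // xi_denom_ge1. Qed.

Lemma conj_xi n : Num.conj (xi a b q v n) = xi a b q v n.
Proof. by apply: conj_Creal; apply: gtr0_real; exact: xi_gt0. Qed.

(** The second row of [mvlqj n] contains this multiple of the monic polynomial
    of degree [n.-1]; its value is forced by orthogonality to the first row of
    [mvlqj n.-1], see [mvlqj_orthogonal]. *)
Definition mixing n : C :=
  - (xi a b q v n * Num.conj v * (norm_ratio a b q n)%:C).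

Lemma conj_mixing n :
  Num.conj (mixing n) = - (xi a b q v n * v * (norm_ratio a b q n)%:C).
Proof.
have gR (x : R) : Num.conj x%:C = x%:C :> C by exact: conjc_real.
rewrite /mixing; have := gR (norm_ratio a b q n).
move: (norm_ratio a b q n)%:C => g gE.
by rewrite rmorphN !rmorphM /= gE conj_xi conjCK.
Qed.

Lemma mixing0 : mixing 0 = 0.
Proof. by rewrite /mixing norm_ratio0 mulr0 oppr0. Qed.

(** This identity, which normalizes the corner of the leading coefficient,
    determines [xi]. *)
Lemma xi_mixing n : xi a b q v n - v * mixing n = 1.
Proof.
have h : 1 + `|v| ^+ 2 * (norm_ratio a b q n)%:C != 0.
  by rewrite gt_eqF // (lt_le_trans ltr01) // xi_denom_ge1.
rewrite /mixing mulrN opprK -{1}[xi _ _ _ _ _]mulr1.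
transitivity (xi a b q v n * (1 + `|v| ^+ 2 * (norm_ratio a b q n)%:C)).
  by rewrite normCK; ring.
by rewrite xiE mulVf.
Qed.

(** The entries of the matrix-valued family in the decoupled coordinates
    [(wrow1, wrow2)].  At [n = 0] the predecessor in [mv21] is harmless, since
    [mixing 0] vanishes. *)
Definition mv11 n : {poly C} := cpoly (lqj (a * q ^+ 2) b q n).
Definition mv12 n : {poly C} := v *: cpoly (lqj a b q n.+1).
Definition mv21 n : {poly C} := mixing n *: cpoly (lqj (a * q ^+ 2) b q n.-1).
Definition mv22 n : {poly C} := xi a b q v n *: cpoly (lqj a b q n).

(** The second original coordinate, recovered from the decoupled ones. *)
Definition recouple f g : {poly C} := g + v *: ((1 - 'X) * f).

Lemma coef_recouple f g j : (recouple f g)`_j =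
  g`_j + v * (f`_j - (if j is i.+1 then f`_i else 0)).
Proof.
by rewrite coefD coefZ mulrBl mul1r coefB coefXM; case: j.
Qed.

Definition mvlqj n : {poly 'M[C]_2} := \poly_(j < n.+1)
  mx2 (mv11 n)`_j (recouple (mv11 n) (mv12 n))`_j
      (mv21 n)`_j (recouple (mv21 n) (mv22 n))`_j.

Let H2 := admissible_shift H.

Lemma mv11_high n j : (n < j)%N -> (mv11 n)`_j = 0.
Proof.
by move=> nj; rewrite coef_cpoly nth_default // (leq_trans (size_lqj _ _ _ _)).
Qed.

Lemma mv21_high n j : (n <= j)%N -> (mv21 n)`_j = 0.
Proof.
case: n => [|n] nj; first by rewrite coefZ mixing0 mul0r.
rewrite coefZ coef_cpoly nth_default ?mulr0 //.
exact: leq_trans (size_lqj _ _ _ _) nj.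
Qed.

(** The coefficient of degree [n.+1] cancels because both polynomials are monic:
    this is why the first row has degree [n] although [mv12] has degree
    [n.+1]. *)
Lemma recouple1_high n j : (n < j)%N -> (recouple (mv11 n) (mv12 n))`_j = 0.
Proof.
case: j => // j; rewrite ltnS coef_recouple coefZ coef_cpoly => nj.
rewrite mv11_high // sub0r; move: nj; rewrite leq_eqVlt => /predU1P[<-|nj].
  by rewrite coef_cpoly !lead_lqj //= rmorph1 mulrN subrr.
rewrite mv11_high // nth_default ?(leq_trans (size_lqj _ _ _ _)) //.
by rewrite oppr0 !mulr0 addr0.
Qed.

Lemma recouple2_high n j : (n < j)%N -> (recouple (mv21 n) (mv22 n))`_j = 0.
Proof.
case: j => // j; rewrite ltnS coef_recouple => nj.
rewrite !mv21_high ?(ltnW nj) //; last exact: leq_trans nj _.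
rewrite coefZ coef_cpoly nth_default ?(leq_trans (size_lqj _ _ _ _)) //.
by rewrite subrr !mulr0 addr0.
Qed.

Lemma entry_mvlqj n : [/\ entry (mvlqj n) 0 0 = mv11 n,
    entry (mvlqj n) 0 1 = recouple (mv11 n) (mv12 n),
    entry (mvlqj n) 1 0 = mv21 n
  & entry (mvlqj n) 1 1 = recouple (mv21 n) (mv22 n)].
Proof.
split; apply/polyP => j; rewrite coef_entry coef_poly; case: ltnP => nj;
  rewrite ?mx2E //= mxE.
- by rewrite mv11_high.
- by rewrite recouple1_high.
- by rewrite mv21_high // ltnW.
- by rewrite recouple2_high.
Qed.

Lemma wrow_mvlqj n : [/\ wrow1 (mvlqj n) 0 = mv11 n, wrow1 (mvlqj n) 1 = mv21 n,
  wrow2 v (mvlqj n) 0 = mv12 n & wrow2 v (mvlqj n) 1 = mv22 n].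
Proof.
by rewrite /wrow1 /wrow2; have [-> -> -> ->] := entry_mvlqj n;
  split; rewrite // /recouple addrK.
Qed.

Lemma lead_mvlqj n : (mvlqj n)`_n = Nmx a b q v n.
Proof.
rewrite coef_poly ltnSn /Nmx; congr mx2.
- by rewrite coef_cpoly lead_lqj.
- have [q0 q1 _ _ _] := H; have h1 := admissible_q 0 H; rewrite expr1 in h1.
  have h2 := admissible_ab (2 * n) H.
  rewrite coef_recouple coefZ !coef_cpoly subleading_lqj // lead_lqj // /alpha.
  rewrite -mulrDr; congr (v * _).
  have -> : (if n is i.+1 then (mv11 n)`_i else 0)
    = (- ((1 - q ^+ n) * (1 - a * q ^+ n.+2)
       / ((1 - q) * (1 - a * b * q ^+ (2 * n).+2))))%:C.
    case: n h2 => [|n] h2; first by rewrite expr0 subrr !mul0r oppr0.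
    rewrite coef_cpoly subleading_lqj //; congr (- (_ / _))%:C.
      by rewrite -(mulrA a) -exprD.
    congr (_ * (1 - _)); rewrite (mulrAC a) -(mulrA (a * b)) -exprD.
    by congr (_ * _ ^+ _).
  rewrite -rmorphB -rmorphD; congr (_%:C).
  move: h2; rewrite mulnS add2n addn2 !exprS (mulnC 2%N) exprM expr2.
  by move: (q ^+ n) => u h2; field; rewrite !gt_eqF.
- by rewrite mv21_high.
- rewrite coef_recouple mv21_high // sub0r coefZ coef_cpoly lead_lqj // mulr1.
  rewrite -[RHS](xi_mixing n) mulrN; congr (_ - v * _).
  case: n => [|n]; first by rewrite mixing0.
  by rewrite coefZ coef_cpoly lead_lqj // mulr1.
Qed.

Lemma size_mvlqj n : (size (mvlqj n) <= n.+1)%N.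
Proof. exact: size_poly. Qed.

Lemma size_wrow1 D k r : (size D <= k)%N -> (size (wrow1 D r) <= k)%N.
Proof. by move=> Dk; rewrite (leq_trans (size_entry _ _ _)). Qed.

Lemma coef_wrow2 D r j : (wrow2 v D r)`_j =
  D`_j r 1 - v * (D`_j r 0 - (if j is i.+1 then D`_i r 0 else 0)).
Proof.
rewrite coefB coefZ mulrBl mul1r coefB coefXM !coef_entry.
by case: j => // j; rewrite coef_entry.
Qed.

(** Against the first row all scalar products vanish by degree.  Against the
    second row two terms survive, both multiples of the coefficient of degree
    [k.-1] of [wrow1 D r], because the degree bound on [D] ties the top
    coefficient of [wrow2 D r] to it; [mixing] is chosen to make them cancel. *)
Lemma mvlqj_orthogonal D k : (size D <= k)%N -> ip a b q v D (mvlqj k) = 0.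
Proof.
case: k => [|k] Dk.
  move: Dk; rewrite leqn0 size_poly_eq0 => /eqP ->.
  by rewrite -(scale0r (0 : {poly 'M[C]_2})) ipZl // mul0mx.
have [c1 c2 c3 c4] := wrow_mvlqj k.+1.
have sz2 r : (size (wrow2 v D r) <= k.+2)%N.
  apply/leq_sizeP => j kj; rewrite coef_wrow2.
  case: j kj => // j kj; rewrite !(nth_default 0) ?(leq_trans Dk) // ?mxE.
    by rewrite subrr mulr0 subr0.
  exact: ltnW.
have hi : D`_k.+1 = 0 by rewrite nth_default.
have ip0 r : ip a b q v D (mvlqj k.+1) r 0 = 0.
  rewrite ipE // mxE /ipform c1 c3 cj_scale !cj_cpoly scale_cpolyr cjfunZ.
  rewrite (mulrC (wrow1 _ _)) (cjfun_lqj H2 (leqW (size_wrow1 r Dk))).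
  rewrite (mulrC (wrow2 _ _ _)) (cjfun_lqj H (leqW (sz2 r))).
  by rewrite coef_entry hi (nth_default 0 (sz2 r)) mxE !mul0r mulr0 addr0.
have ip1 r : ip a b q v D (mvlqj k.+1) r 1 = 0.
  rewrite ipE // mxE /ipform c2 c4 !cj_scale !cj_cpoly !scale_cpolyr !cjfunZ.
  rewrite (mulrC (wrow1 _ _)) (cjfun_lqj H2 (size_wrow1 r Dk)).
  rewrite (mulrC (wrow2 _ _ _)) (cjfun_lqj H (sz2 r)).
  rewrite coef_entry coef_wrow2 hi !mxE !sub0r conj_xi.
  rewrite conj_mixing lqj_norm_ratio // real_complexM /=; ring.
by apply: mx2P; rewrite ?ip0 ?ip1 mxE.
Qed.

Definition mvlqj_norm n : 'M[C]_2 :=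
  mx2 ((lqj_norm (a * q ^+ 2) b q n)%:C + `|v| ^+ 2 * (lqj_norm a b q n.+1)%:C)
      0 0
      (`|mixing n| ^+ 2 * (lqj_norm (a * q ^+ 2) b q n.-1)%:C
        + `|xi a b q v n| ^+ 2 * (lqj_norm a b q n)%:C).

Lemma ip_mvlqj n : ip a b q v (mvlqj n) (mvlqj n) = mvlqj_norm n.
Proof.
have [c1 c2 c3 c4] := wrow_mvlqj n; rewrite ipE //.
have off x : (n == n.-1)%:R * (mixing n * x) = 0 :> C.
  case: n {c1 c2 c3 c4} => [|n]; last by rewrite gtn_eqF // mul0r.
  by rewrite mixing0 mul0r mulr0.
have off' x : (n == n.-1)%:R * (Num.conj (mixing n) * x) = 0 :> C.
  case: n {c1 c2 c3 c4 off} => [|n]; last by rewrite gtn_eqF // mul0r.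
  by rewrite mixing0 rmorph0 mul0r mulr0.
apply: mx2P; rewrite mxE mx2E /= /ipform ?c1 ?c2 ?c3 ?c4;
  rewrite ?cj_scale !cj_cpoly ?scale_cpolyl ?scale_cpolyr ?cjfunZ
          ?scale_cpolyl ?cjfunZ !cjfun_lqj_lqj // ?eqxx.
- by rewrite !mul1r mulrA normCK.
- by rewrite mulrCA off' add0r gtn_eqF // mul0r !mulr0.
- by rewrite mulrCA eq_sym off add0r ltn_eqF // mul0r !mulr0.
- by rewrite !mul1r !mulrA !normCK.
Qed.

Lemma mvlqj_norm_neq0 n : mvlqj_norm n 0 0 != 0 /\ mvlqj_norm n 1 1 != 0.
Proof.
have pos a' m : admissible a' b q -> 0 < (lqj_norm a' b q m)%:C :> C.
  by move=> H'; rewrite ltcR lqj_norm_gt0.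
rewrite !mx2E /=; split; rewrite gt_eqF //.
  by rewrite ltr_wpDr ?pos // mulr_ge0 ?exprn_ge0 // ltW // pos.
rewrite ltr_wpDl ?mulr_ge0 ?exprn_ge0 // ?ltW ?pos //.
by rewrite mulr_gt0 ?pos // exprn_gt0 // normr_gt0 gt_eqF // xi_gt0.
Qed.

Definition Nmx_inv n : 'M[C]_2 := mx2 1 (- alpha a b q v n) 0 1.

Lemma Nmx_invK n : Nmx_inv n *m Nmx a b q v n = 1%:M.
Proof.
rewrite mx2_mul !(mul0r, mul1r, mulr0, mulr1, addr0, add0r) subrr.
by apply: mx2P; rewrite !mxE.
Qed.

(** Subtracting from [D] the multiple of [mvlqj n] with the same leading
    coefficient leaves a polynomial of lower degree, which is orthogonal to
    [mvlqj n]; as the norm of [mvlqj n] is invertible, the multiple is 0. *)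
Lemma mvlqj_separates D n : (size D <= n)%N ->
  (forall k, (k < n)%N -> ip a b q v D (mvlqj k) = 0) -> D = 0.
Proof.
elim: n => [|n IHn] Dn D0.
  by move: Dn; rewrite leqn0 size_poly_eq0 => /eqP.
(* [M] is chosen so that [M *: mvlqj n] has the same leading coefficient
   as [D]. *)
have [M ME] : exists M, M *m Nmx a b q v n = D`_n.
  by exists (D`_n *m Nmx_inv n); rewrite -mulmxA Nmx_invK mulmx1.
pose D' := D - M *: mvlqj n.
have D'n : (size D' <= n)%N.
  apply/leq_sizeP => j; rewrite leq_eqVlt coefB coefZ => /predU1P[<-|nj].
    by rewrite lead_mvlqj -mulmxE ME subrr.
  rewrite !(nth_default 0) ?mulr0 ?subrr // ?(leq_trans Dn) //.
  by rewrite (leq_trans (size_mvlqj n)).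
have DE : D = M *: mvlqj n + D' by rewrite /D' addrC subrK.
have M0 : M *m mvlqj_norm n = 0.
  rewrite -(D0 n (ltnSn n)) DE ip_lin // (mvlqj_orthogonal D'n) addr0.
  by rewrite ip_mvlqj.
have [d0 e0] := mvlqj_norm_neq0 n.
have Mz : M = 0.
  have Mr r : M r 0 = 0 /\ M r 1 = 0.
    have := congr1 (fun X : 'M[C]_2 => X r 0) M0.
    have := congr1 (fun X : 'M[C]_2 => X r 1) M0.
    rewrite !mxE !sum_ord2 [mvlqj_norm n 0 1]mx2E [mvlqj_norm n 1 0]mx2E /=.
    rewrite !mulr0 addr0 add0r => /eqP + /eqP.
    by rewrite !mulf_eq0 (negPf d0) (negPf e0) !orbF => /eqP -> /eqP ->.
  by apply: mx2P; rewrite ?(Mr 0).1 ?(Mr 0).2 ?(Mr 1).1 ?(Mr 1).2 mxE.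
have DD' : D = D' by rewrite DE Mz scale0r add0r.
by apply: IHn => [|k kn]; [rewrite DD'|apply: D0; exact: ltnW].
Qed.

(** [Nmx n *: P n - mvlqj n] has degree below [n], and by induction it is
    orthogonal to every [mvlqj k] with [k < n]. *)
Lemma mvlqj_unique (P : nat -> {poly 'M[C]_2}) :
  monic_orthogonal a b q v P -> forall n, Nmx a b q v n *: P n = mvlqj n.
Proof.
move=> [Pm Po]; elim/ltn_ind => n IHn.
apply/eqP; rewrite -subr_eq0; apply/eqP; apply: (@mvlqj_separates _ n).
  apply/leq_sizeP => j; rewrite leq_eqVlt coefB coefZ => /predU1P[<-|nj].
    have [sP /monicP] := Pm n; rewrite lead_coefE sP /= => ->.
    by rewrite lead_mvlqj mulr1 subrr.
  rewrite !(nth_default 0) ?mulr0 ?subrr //.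
    by rewrite (leq_trans (size_mvlqj n)).
  by rewrite (Pm n).1.
move=> k kn.
have e : Nmx a b q v n *: P n - mvlqj n
    = (- 1) *: mvlqj n + Nmx a b q v n *: P n.
  by rewrite scaleN1r addrC.
rewrite e ip_lin // [ip _ _ _ _ (mvlqj n) _]ip_adj //.
rewrite mvlqj_orthogonal; last first.
  by rewrite (leq_trans (size_mvlqj k)).
rewrite trmx0 map_mx0 mulmx0 add0r -IHn // ipZl // ipZr // Po.
  by rewrite mul0mx mulmx0.
by move=> nk; rewrite nk ltnn in kn.
Qed.

Lemma norm_real_sq (x : R) : `|x%:C : C| ^+ 2 = (x ^+ 2)%:C.
Proof.
rewrite normCK (_ : Num.conj x%:C = x%:C); last exact: conjc_real.
by rewrite expr2 real_complexM.
Qed.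

Lemma norm_sign n : `|(-1) ^+ n : C| = 1.
Proof. by rewrite normrX normrN1 expr1n. Qed.

Lemma kappa11E n : kappa11 a b q n
  = (-1) ^+ n * (inv_lead (a * q ^+ 2) b q n)%:C.
Proof.
have -> : (-1) ^+ n = ((-1) ^+ n)%:C :> C by rewrite rmorphXn rmorphN1.
rewrite -real_complexM /kappa11 /inv_lead -mulrA.
have -> : a * q ^+ 2 * q = a * q ^+ 3 by ring.
have -> : a * q ^+ 2 * b * q ^+ n.+1 = a * b * q ^+ (n + 3).
  by rewrite addn3 (mulrAC a) -(mulrA (a * b)) -exprD.
by [].
Qed.

Lemma kappa12E n : kappa12 a b q v n
  = (-1) ^+ n.+1 * v * (inv_lead a b q n.+1)%:C.
Proof. by rewrite /kappa12 addn2. Qed.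

Lemma kappa22E n : kappa22 a b q v n
  = (-1) ^+ n * xi a b q v n * (inv_lead a b q n)%:C.
Proof. by []. Qed.

(** The multiplier [mixing], a quotient of norms, turns into the product formula
    once [norm_ratio] is absorbed by the shifted factorials. *)
Lemma kappa21E n : kappa21 a b q v n.+1
  = (-1) ^+ n * mixing n.+1 * (inv_lead (a * q ^+ 2) b q n)%:C.
Proof.
have [q0 q1 a0 aq bq] := H.
rewrite /kappa21 /mixing exprS.
have -> : 'C(n.+1, 2)%:Z - n.+1%:Z + 2 = 'C(n, 2).+1%:Z.
  by rewrite binS bin1 PoszD -[n.+1]addn1 -[_.+1]addn1 !PoszD; ring.
rewrite -exprnP.
suff e : a * (q ^+ 'C(n, 2).+1
     * ((1 - q ^+ n.+1) * (1 - b * q ^+ n.+1)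
        / ((1 - a * q) * (1 - a * q ^+ 2)))
     * (qpoch (a * q) q n.+1 / qpoch (a * b * q ^+ n.+2) q n.+1))
    = norm_ratio a b q n.+1 * inv_lead (a * q ^+ 2) b q n.
  set X := (X in _ * X%:C = _) in e *.
  transitivity (- ((-1) ^+ n * xi a b q v n.+1 * Num.conj v * (a * X)%:C)).
    by rewrite real_complexM; ring.
  by rewrite e real_complexM; ring.
have h1 := admissible_a 0 H; have h2 := admissible_a 1 H.
have h3 := admissible_a n.+1 H; have h4 := admissible_ab n H.
have pa : qpoch (a * q) q n.+1 * (1 - a * q ^+ n.+2)
    = (1 - a * q) * (1 - a * q ^+ 2) * qpoch (a * q ^+ 2 * q) q n.
  have -> : a * q ^+ n.+2 = a * q * q ^+ n.+1 by rewrite -mulrA -exprS.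
  have -> : a * q ^+ 2 = a * q * q by ring.
  by rewrite -qpochSr !qpochS mulrA.
have pb : qpoch (a * b * q ^+ n.+2) q n.+1
    = (1 - a * b * q ^+ n.+2) * qpoch (a * q ^+ 2 * b * q ^+ n.+1) q n.
  rewrite qpochS; congr (_ * qpoch _ _ _).
  by rewrite !exprS; ring.
have pb0 : 0 < qpoch (a * q ^+ 2 * b * q ^+ n.+1) q n.
  apply: qpoch_gt0 => //; rewrite (mulrAC a) -(mulrA (a * b)) -exprD.
  by rewrite -subr_gt0; exact: (admissible_ab n.+1 H).
rewrite expr1 in h1.
have -> : qpoch (a * q) q n.+1 = (1 - a * q) * (1 - a * q ^+ 2)
    * qpoch (a * q ^+ 2 * q) q n / (1 - a * q ^+ n.+2).
  by rewrite -pa mulfK // gt_eqF.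
rewrite pb /norm_ratio /inv_lead (exprS q 'C(n, 2)).
move: h1 h2 h3 h4 pb0; move: (qpoch _ _ _) (qpoch _ _ _) (q ^+ 'C(n, 2)) => *.
by field; rewrite !gt_eqF.
Qed.

Lemma Hmx_mvlqj_norm n : Hmx a b q v n = mvlqj_norm n.
Proof.
have sq a' m : admissible a' b q ->
    ((inv_lead a' b q m) ^+ 2)%:C * (hnorm a' b q m)%:C
      = (lqj_norm a' b q m)%:C :> C.
  by move=> H'; rewrite -real_complexM hnorm_lqj.
rewrite /Hmx /mvlqj_norm; congr (mx2 (_ + _) _ _ (_ + _)).
- by rewrite kappa11E normrM norm_sign mul1r norm_real_sq sq.
- by rewrite kappa12E !normrM norm_sign mul1r exprMn norm_real_sq -mulrA sq.
- case: n => [|n]; first by rewrite mixing0 normr0 expr0n mul0r.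
  by rewrite kappa21E !normrM norm_sign mul1r exprMn norm_real_sq -mulrA sq.
- by rewrite kappa22E !normrM norm_sign mul1r exprMn norm_real_sq -mulrA sq.
Qed.

End MatrixFamily.

Theorem corollary5p6 (R : realType) (q a b : R) (v : R[i])
    (P : nat -> {poly 'M[R[i]]_2})
    (hq0 : 0 < q) (hq1 : q < 1) (ha0 : 0 < a) (ha : a < q^-1) (hb : b < q^-1)
    (hP : monic_orthogonal a b q v P) (m n : nat) :
  let Pt k := Nmx a b q v k *: P k in
  cvgn (ip_partial a b q v (Pt m) (Pt n)) /\
  ip a b q v (Pt m) (Pt n) = (if m == n then Hmx a b q v n else 0).
Proof.
have H : admissible a b q.
  by split=> //; rewrite -ltr_pdivlMr // div1r.
move=> Pt; split; first exact: is_cvg_ip.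
rewrite /Pt !(mvlqj_unique H hP).
case: (ltngtP m n) => [mn|nm|->].
- by rewrite mvlqj_orthogonal // (leq_trans (size_mvlqj _ _ _ _ _)).
- rewrite ip_adj // mvlqj_orthogonal ?trmx0 ?map_mx0 //.
  by rewrite (leq_trans (size_mvlqj _ _ _ _ _)).
- by rewrite ip_mvlqj // Hmx_mvlqj_norm.
Qed.
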